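(* Let $\mathcal S$ be a simple bundle of circles in $\mathbb{R}^4$ whose set of tangent directions at $0$ is Zariski dense, and suppose $\mathcal S$ is rectifiable. Then there exist affine maps $A,B:\mathbb{R}^4\to\mathbb{R}^4$ such that the map $T$ given either by $T(x)=B(x)^{-1}A(x)$ or by $T(x)=A(x)B(x)^{-1}$ satisfies $T(0)=0$, is a local diffeomorphism at $0$, and $T^{-1}$ maps the germ at $0$ of every circle of $\mathcal S$ into a straight line.
   Context: A *circle* in $\mathbb{R}^4$ means either a round Euclidean circle or a straight line. A *simple bundle of circles* is a collection of circles all passing through $0$, no two tangent at $0$; it is *rectifiable* if some germ at $0$ of a smooth diffeomorphism $(\mathbb{R}^4,0)\to(\mathbb{R}^4,0)$ maps the germ at $0$ of every circle of the collection into a straight line. A set $\mathcal D$ of lines through $0$ in $\mathbb{R}^4$ is *Zariski dense* if every homogeneous real polynomial on $\mathbb{R}^4$ vanishing on all lines of $\mathcal D$ is identically zero. $\mathbb{R}^4$ is identified with the quaternions $\mathbb{H}$ by sending an orthonormal basis to $1,i,j,k$; products and inverses are quaternionic. *)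

(* Defs.v *)
From HB Require Import structures.
From mathcomp Require Import all_boot all_order all_algebra.
From mathcomp Require Import all_classical all_reals all_analysis.
From mathcomp Require mpoly.
Import (canonicals) mpoly.
Set Implicit Arguments. Unset Strict Implicit. Unset Printing Implicit Defensive.
Import Order.TTheory GRing.Theory Num.Theory.
Import numFieldNormedType.Exports.
Local Open Scope classical_set_scope.
Local Open Scope ring_scope.

(* R^4 as row vectors; coordinate i (i = 0,1,2,3) corresponds to the
   quaternion unit 1, i, j, k respectively (standard orthonormal basis). *)
Notation R4 R := 'rV[R]_4.

Section Defs.
Variable R : realType.
Local Notation V := (R4 R).

Definition e0 : 'I_4 := @Ordinal 4 0 isT.
Definition e1 : 'I_4 := @Ordinal 4 1 isT.
Definition e2 : 'I_4 := @Ordinal 4 2 isT.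
Definition e3 : 'I_4 := @Ordinal 4 3 isT.

Definition dot (x y : V) : R := \sum_(i < 4) x 0 i * y 0 i.

Definition mkq (a b c d : R) : V :=
  \row_(i < 4) [:: a; b; c; d]`_i.

(* Hamilton product: (a1 + b1 i + c1 j + d1 k)(a2 + b2 i + c2 j + d2 k) *)
Definition qmul (x y : V) : V :=
  let a1 := x 0 e0 in let b1 := x 0 e1 in let c1 := x 0 e2 in let d1 := x 0 e3 in
  let a2 := y 0 e0 in let b2 := y 0 e1 in let c2 := y 0 e2 in let d2 := y 0 e3 in
  mkq (a1*a2 - b1*b2 - c1*c2 - d1*d2)
      (a1*b2 + b1*a2 + c1*d2 - d1*c2)
      (a1*c2 - b1*d2 + c1*a2 + d1*b2)
      (a1*d2 + b1*c2 - c1*b2 + d1*a2).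

(* quaternion conjugate and inverse (conj x / |x|^2; the value at 0 is 0,
   which is never used: the statement requires the inverted quantity to be
   nonzero at 0) *)
Definition qconj (x : V) : V :=
  mkq (x 0 e0) (- x 0 e1) (- x 0 e2) (- x 0 e3).
Definition qinv (x : V) : V := (dot x x)^-1 *: qconj x.

Definition affine (A : V -> V) : Prop :=
  exists (M : 'M[R]_4) (b : V), forall x, A x = x *m M + b.

Definition line_set (p d : V) : set V := [set p + t *: d | t in @setT R].
Definition is_line (L : set V) : Prop :=
  exists p d : V, d != 0 /\ L = line_set p d.

Definition circ_pt (c u v : V) (r t : R) : V :=
  c + (r * cos t) *: u + (r * sin t) *: v.
Definition circle_set (c u v : V) (r : R) : set V :=
  [set circ_pt c u v r t | t in @setT R].
Definition orthonormal2 (u v : V) : Prop :=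
  dot u u = 1 /\ dot v v = 1 /\ dot u v = 0.

Definition is_circle (C : set V) : Prop :=
  (exists c u v r, 0 < r /\ orthonormal2 u v /\ C = circle_set c u v r)
  \/ is_line C.

(* w is a tangent vector at 0 of the circle C (which passes through 0):
   the velocity at the point 0 of a regular parametrization of C. *)
Definition tangent_dir0 (C : set V) (w : V) : Prop :=
  (exists c u v r t0, 0 < r /\ orthonormal2 u v /\ C = circle_set c u v r /\
     circ_pt c u v r t0 = 0 /\ w = (- (r * sin t0)) *: u + (r * cos t0) *: v)
  \/ (exists p d t0, d != 0 /\ C = line_set p d /\ p + t0 *: d = 0 /\ w = d).

Definition parallel (w1 w2 : V) : Prop := exists k : R, w2 = k *: w1.

Definition simple_bundle (S : set (set V)) : Prop :=
  (forall C, S C -> is_circle C /\ C 0) /\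
  (forall C1 C2 w1 w2, S C1 -> S C2 -> C1 <> C2 ->
     tangent_dir0 C1 w1 -> tangent_dir0 C2 w2 -> ~ parallel w1 w2).

Definition peval (p : mpoly.mpoly 4%N R) (x : V) : R :=
  mpoly.meval (fun i : 'I_4 => x 0 i) p.

(* p is homogeneous of degree d (multinomials' [d.-homog], total degree) *)
Definition is_homog (d : nat) (p : mpoly.mpoly 4%N R) : bool :=
  p \is mpoly.ishomog1 d (mpoly.Measure.clone 4%N (@mpoly.mdeg 4%N) _).

Definition tangent_zariski_dense (S : set (set V)) : Prop :=
  forall (d : nat) (p : mpoly.mpoly 4%N R),
    is_homog d p ->
    (forall C w (k : R), S C -> tangent_dir0 C w -> peval p (k *: w) = 0) ->
    p = 0.

Fixpoint iter_dir (vs : seq V) (f : V -> V) : V -> V :=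
  match vs with
  | [::] => f
  | v :: vs' => fun x => 'D_v (iter_dir vs' f) x
  end.
Definition smooth_on (U : set V) (f : V -> V) : Prop :=
  forall (vs : seq V) (x : V), U x ->
    {for x, continuous (iter_dir vs f)} /\
    (forall v, derivable (iter_dir vs f) x v).

Definition local_diffeo0 (f g : V -> V) (U W : set V) : Prop :=
  open U /\ open W /\ U 0 /\ f 0 = 0 /\
  (forall x, U x -> W (f x) /\ g (f x) = x) /\
  (forall y, W y -> U (g y) /\ f (g y) = y) /\
  smooth_on U f /\ smooth_on W g.

Definition maps_germ_into_line (f : V -> V) (C : set V) : Prop :=
  exists L, is_line L /\ \forall x \near (0 : V), C x -> L (f x).

Definition rectifiable (S : set (set V)) : Prop :=
  exists f g U W, local_diffeo0 f g U W /\
    forall C, S C -> maps_germ_into_line f C.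

End Defs.

(* Main.v *)
Require Import Defs.
From HB Require Import structures.
From mathcomp Require Import all_boot all_order all_algebra.
From mathcomp Require Import all_classical all_reals all_analysis.
From mathcomp Require mpoly.
Import (canonicals) mpoly.
From mathcomp Require Import ring lra.
Import Order.TTheory GRing.Theory Num.Theory.
Import numFieldNormedType.Exports.
Local Open Scope classical_set_scope.
Local Open Scope ring_scope.

(** The coefficient of t^2 by itself only expresses k through G2. The constraints come from orders 3
    and 4, where the same k returns: modulo |v|^2, order 3 leaves <v, G2>^2 = 0 and order 4 leaves
    |w|^4 = 0. Since k is not known to be polynomial in v, it has to be eliminated before density
    can be applied. The two forms of T reflect the two rulings of the complex quadric |v|^2 = 0.
    Over a null v the pair v, w(v) spans an isotropic subspace, and exactly two isotropic planes
    pass through v, namely the multiples b v and the multiples v b. Irreducibility makes one choice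
    valid for all v; the proof stays over the reals by using primality of |v|^2 instead. Smoothness
    is given through iterated directional derivatives, so polynomiality of the Gn has to be derived:
    continuous partial derivatives give differentiability, hence linearity in the direction.
    Normalisation at 0 is done by differentiating g along v K, where K is the Jacobian matrix of f
    at 0. No inverse function theorem is needed for T, because T x = y becomes linear in x once the
    denominator is cleared. *)

(* Let g be the inverse of the rectifying diffeomorphism.  Normalised at 0, it
   sends the line of direction v to the circle of the bundle tangent to v, and
   the circle with curvature vector k is
     { x | |v|^2 x = <x, v> v + |v|^2 |x|^2 k }.
   Write g(tv) = tv + t^2 G2(v) + t^3 G3(v) + t^4 G4(v) + ..., where Gn is
   homogeneous of degree n.  Eliminating k from the coefficients of t^2, t^3
   and t^4 gives polynomial identities in v, which hold for all v by Zariski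
   density.  Since |v|^2 is a prime polynomial, they force
   G2(v) = l(v) v + w(v) with l linear, w(v) orthogonal to v and |w(v)|^2
   divisible by |v|^2.  Modulo |v|^2 every product of a coordinate of w(v) v^*
   with one of v^* w(v) then vanishes, so one of these two quaternions is
   divisible by |v|^2, that is, w(v) = b(v) v or w(v) = v b(v) with b linear.
   On the tangent vectors w(v) = |v|^2 k, and T(x) = (1 - b(x))^{-1} x,
   respectively x (1 - b(x))^{-1}, maps the line of direction v onto the
   circle with curvature vector k. *)

Set Implicit Arguments. Unset Strict Implicit. Unset Printing Implicit Defensive.

(** * Polynomial functions and primality of the norm form *)

Section PolynomialFunctions.
Variable R : realType.
Local Notation V := (R4 R).

(** Polynomials are treated as functions, so that identities are proved pointwise by [ring] and
    restrictions to lines fall into [{poly R}]. Formal polynomials enter only in [hpolyf_peval],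
    where Zariski density is used. *)
Inductive polyf : (V -> R) -> Prop :=
| polyf_cst c : polyf (fun=> c)
| polyf_coord i : polyf (fun x => x 0 i)
| polyf_add F G : polyf F -> polyf G -> polyf (fun x => F x + G x)
| polyf_mul F G : polyf F -> polyf G -> polyf (fun x => F x * G x).

Inductive hpolyf : nat -> (V -> R) -> Prop :=
| hpolyf_cst c : hpolyf 0 (fun=> c)
| hpolyf_0 d : hpolyf d (fun=> 0)
| hpolyf_coord i : hpolyf 1 (fun x => x 0 i)
| hpolyf_add d F G : hpolyf d F -> hpolyf d G -> hpolyf d (fun x => F x + G x)
| hpolyf_mul d e F G : hpolyf d F -> hpolyf e G ->
    hpolyf (d + e) (fun x => F x * G x).

Lemma polyf_ext F G : F =1 G -> polyf G -> polyf F.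
Proof. by move=> /funext ->. Qed.

Lemma hpolyf_ext d F G : F =1 G -> hpolyf d G -> hpolyf d F.
Proof. by move=> /funext ->. Qed.

Lemma polyf_opp F : polyf F -> polyf (fun x => - F x).
Proof.
move=> hF; apply: (@polyf_ext _ (fun x => -1 * F x)) => [x|]; first by rewrite mulN1r.
by apply: polyf_mul => //; exact: polyf_cst.
Qed.

Lemma polyf_sum (I : Type) (r : seq I) (P : pred I) (F : I -> V -> R) :
  (forall i, polyf (F i)) -> polyf (fun x => \sum_(i <- r | P i) F i x).
Proof.
move=> hF; elim: r => [|i r IH].
  by apply: (@polyf_ext _ (fun=> 0)) => [x|]; [rewrite big_nil|exact: polyf_cst].
apply: (@polyf_ext _ (fun x => (if P i then F i x else 0) + \sum_(i <- r | P i) F i x)).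
  by move=> x; rewrite big_cons; case: (P i) => //; rewrite add0r.
by apply: polyf_add => //; case: (P i) => //; exact: polyf_cst.
Qed.

Lemma polyf_prod (I : Type) (r : seq I) (P : pred I) (F : I -> V -> R) :
  (forall i, polyf (F i)) -> polyf (fun x => \prod_(i <- r | P i) F i x).
Proof.
move=> hF; elim: r => [|i r IH].
  by apply: (@polyf_ext _ (fun=> 1)) => [x|]; [rewrite big_nil|exact: polyf_cst].
apply: (@polyf_ext _ (fun x => (if P i then F i x else 1) * \prod_(i <- r | P i) F i x)).
  by move=> x; rewrite big_cons; case: (P i) => //; rewrite mul1r.
by apply: polyf_mul => //; case: (P i) => //; exact: polyf_cst.
Qed.

Lemma hpolyf_opp d F : hpolyf d F -> hpolyf d (fun x => - F x).
Proof.
move=> hF; apply: (@hpolyf_ext _ _ (fun x => -1 * F x)) => [x|].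
  by rewrite mulN1r.
exact: (hpolyf_mul (hpolyf_cst (-1)) hF).
Qed.

Lemma hpolyf_scale d c F : hpolyf d F -> hpolyf d (fun x => c * F x).
Proof. by move=> hF; exact: (hpolyf_mul (hpolyf_cst c) hF). Qed.

Lemma hpolyf_sum d n (F : 'I_n -> V -> R) :
  (forall i, hpolyf d (F i)) -> hpolyf d (fun x => \sum_(i < n) F i x).
Proof.
elim: n F => [F _|n IHn F hF].
  by apply: (@hpolyf_ext _ _ (fun=> 0)) => [x|]; [rewrite big_ord0|exact: hpolyf_0].
apply: (@hpolyf_ext _ _ (fun x => \sum_(i < n) F (widen_ord (leqnSn n) i) x + F ord_max x)).
  by move=> x; rewrite big_ord_recr.
by apply: hpolyf_add => //; apply: IHn.
Qed.

Lemma hpolyf_polyf d F : hpolyf d F -> polyf F.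
Proof.
elim=> *; [exact: polyf_cst|exact: polyf_cst|exact: polyf_coord|exact: polyf_add|exact: polyf_mul].
Qed.

Lemma hpolyfZ d F t x : hpolyf d F -> F (t *: x) = t ^+ d * F x.
Proof.
elim=> [c|e|i|e G H _ IHG _ IHH|e e' G H _ IHG _ IHH].
- by rewrite expr0 mul1r.
- by rewrite mulr0.
- by rewrite mxE expr1.
- by rewrite IHG IHH mulrDr.
- by rewrite IHG IHH exprD mulrACA.
Qed.

Lemma hpolyf_peval d F : hpolyf d F ->
  exists2 p, is_homog d p & F =1 peval p.
Proof.
elim=> [c|e|i|e G H _ [p hp pE] _ [q hq qE]|e e' G H _ [p hp pE] _ [q hq qE]].
- exists (mpoly.mpolyC 4 c) => [|x]; last by rewrite /peval mpoly.mevalC.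
  apply/mpoly.dhomogP => m; rewrite mpoly.msuppC; case: ifP => // _.
  by rewrite inE => /eqP ->; exact: mpoly.mdeg0.
- by exists 0 => [|x]; [exact: mpoly.dhomog0|rewrite /peval mpoly.meval0].
- exists (mpoly.mpolyX _ (mpoly.mnm1 i)) => [|x]; last by rewrite /peval mpoly.mevalXU.
  by rewrite /is_homog mpoly.dhomogX /= mpoly.mdeg1.
- exists (p + q) => [|x]; first exact: mpoly.dhomogD.
  by rewrite pE qE /peval mpoly.mevalD.
- exists (p * q) => [|x]; first exact: mpoly.dhomogM.
  by rewrite pE qE /peval mpoly.mevalM.
Qed.

Lemma polyf_line F (x y : V) : polyf F ->
  exists p : {poly R}, forall t, F (x + t *: y) = p.[t].
Proof.
elim=> [c|i|G H _ [p pE] _ [q qE]|G H _ [p pE] _ [q qE]].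
- by exists c%:P => t; rewrite hornerC.
- by exists ((x 0 i)%:P + (y 0 i) *: 'X) => t; rewrite !mxE !hornerE mulrC.
- by exists (p + q) => t; rewrite pE qE hornerD.
- by exists (p * q) => t; rewrite pE qE hornerM.
Qed.

Lemma poly_ext (p q : {poly R}) : (forall t, p.[t] = q.[t]) -> p = q.
Proof.
move=> pq; apply/eqP; rewrite -subr_eq0; apply/negPn/negP => nz.
(* The integers below the size of p - q are one root too many for a nonzero polynomial. *)
have := @max_poly_roots _ (p - q) [seq i%:R | i <- iota 0 (size (p - q))] nz.
rewrite size_map size_iota ltnn => H; apply/notF/H.
  by apply/allP => t _; rewrite /root hornerD hornerN pq subrr.
by rewrite map_inj_uniq ?iota_uniq // => i j /eqP; rewrite eqr_nat => /eqP.
Qed.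

(** Restrict to the line joining a point where F is nonzero to a point where G is nonzero: a product
    of nonzero one-variable polynomials would vanish. *)
Lemma polyf_integral F G : polyf F -> polyf G -> (forall x, F x * G x = 0) ->
  (forall x, F x = 0) \/ (forall x, G x = 0).
Proof.
move=> hF hG FG.
have [|/existsNP [x Fx]] := pselect (forall x, F x = 0); first by left.
have [|/existsNP [y Gy]] := pselect (forall x, G x = 0); first by right.
have [p pE] := polyf_line x (y - x) hF; have [q qE] := polyf_line x (y - x) hG.
have /eqP : p * q = 0 by apply: poly_ext => t; rewrite hornerM -pE -qE FG horner0.
rewrite mulf_eq0 => /orP[] /eqP E0.
  by case: Fx; have := pE 0; rewrite scale0r addr0 E0 horner0.
by case: Gy; have := qE 1; rewrite scale1r addrC subrK E0 horner0.
Qed.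

(** Invariance under [imq] is how independence of the real coordinate is expressed for the
    remainders below. *)
Definition imq (x : V) : V := mkq 0 (x 0 e1) (x 0 e2) (x 0 e3).

Lemma sum4 (F : 'I_4 -> R) : \sum_(i < 4) F i = F e0 + F e1 + F e2 + F e3.
Proof.
rewrite !big_ord_recr big_ord0 /= add0r.
by congr (F _ + F _ + F _ + F _); exact: val_inj.
Qed.

Lemma dotE (x y : V) : dot x y =
  x 0 e0 * y 0 e0 + x 0 e1 * y 0 e1 + x 0 e2 * y 0 e2 + x 0 e3 * y 0 e3.
Proof. by rewrite /dot sum4. Qed.

Lemma ord4P (P : 'I_4 -> Prop) : P e0 -> P e1 -> P e2 -> P e3 -> forall i, P i.
Proof.
move=> p0 p1 p2 p3 [[|[|[|[|//]]]] lt_i4].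
- by rewrite (_ : Ordinal _ = e0) //; exact: val_inj.
- by rewrite (_ : Ordinal _ = e1) //; exact: val_inj.
- by rewrite (_ : Ordinal _ = e2) //; exact: val_inj.
- by rewrite (_ : Ordinal _ = e3) //; exact: val_inj.
Qed.

Lemma R4P (x y : V) : x 0 e0 = y 0 e0 -> x 0 e1 = y 0 e1 -> x 0 e2 = y 0 e2 ->
  x 0 e3 = y 0 e3 -> x = y.
Proof.
move=> h0 h1 h2 h3; apply/rowP; exact: (@ord4P (fun i => x 0 i = y 0 i)).
Qed.

Lemma mkq0 (a b c d : R) : mkq a b c d 0 e0 = a. Proof. by rewrite mxE. Qed.
Lemma mkq1 (a b c d : R) : mkq a b c d 0 e1 = b. Proof. by rewrite mxE. Qed.
Lemma mkq2 (a b c d : R) : mkq a b c d 0 e2 = c. Proof. by rewrite mxE. Qed.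
Lemma mkq3 (a b c d : R) : mkq a b c d 0 e3 = d. Proof. by rewrite mxE. Qed.
Definition mkqs := (mkq0, mkq1, mkq2, mkq3).

Lemma polyf_dot (X Y : V -> V) : (forall i, polyf (fun x => X x 0 i)) ->
  (forall i, polyf (fun x => Y x 0 i)) -> polyf (fun x => dot (X x) (Y x)).
Proof. by move=> hX hY; apply: polyf_sum => i; apply: polyf_mul. Qed.

Lemma hpolyf_dot d e (X Y : V -> V) : (forall i, hpolyf d (fun x => X x 0 i)) ->
  (forall i, hpolyf e (fun x => Y x 0 i)) ->
  hpolyf (d + e) (fun x => dot (X x) (Y x)).
Proof. by move=> hX hY; apply: hpolyf_sum => i; apply: hpolyf_mul. Qed.

(* Division with remainder by |x|^2, monic of degree 2 in the real coordinate. *)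
Lemma polyf_divmod F : polyf F -> exists A B Q, [/\ polyf A, polyf B & polyf Q] /\
  [/\ forall x, A (imq x) = A x, forall x, B (imq x) = B x &
      forall x, F x = A x + x 0 e0 * B x + dot x x * Q x].
Proof.
have pS : polyf (fun x => dot x x) by apply: polyf_dot => i; exact: polyf_coord.
elim=> [c|i|G H _ [A [B [Q [[hA hB hQ] [iA iB E]]]]] _ [A' [B' [Q' [[hA' hB' hQ'] [iA' iB' E']]]]]
  |G H _ [A [B [Q [[hA hB hQ] [iA iB E]]]]] _ [A' [B' [Q' [[hA' hB' hQ'] [iA' iB' E']]]]]].
- exists (fun=> c), (fun=> 0), (fun=> 0).
  by split; split=> //; try exact: polyf_cst; move=> x; rewrite !mulr0 !addr0.
- have hc : polyf (fun x : V => x 0 i) := polyf_coord i.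
  have [->|ni0] := eqVneq i e0.
    exists (fun=> 0), (fun=> 1), (fun=> 0).
    by split; split=> //; try exact: polyf_cst; move=> x; rewrite mulr1 mulr0 add0r addr0.
  exists (fun x => x 0 i), (fun=> 0), (fun=> 0).
  split; split => //; try exact: polyf_cst; last by move=> x; rewrite !mulr0 !addr0.
  move=> x; rewrite /imq.
  by move: i {hc} ni0; apply: ord4P => //; rewrite mkqs.
- exists (fun x => A x + A' x), (fun x => B x + B' x), (fun x => Q x + Q' x).
  split; first by split; apply: polyf_add.
  split=> x; [by rewrite iA iA'|by rewrite iB iB'|rewrite E E'; ring].
- pose r2 (x : V) := x 0 e1 * x 0 e1 + (x 0 e2 * x 0 e2 + x 0 e3 * x 0 e3).
  have pr2 : polyf r2 by do 2?apply: polyf_add; apply: polyf_mul; exact: polyf_coord.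
  (* In (A + x0 B)(A' + x0 B') the square x0^2 is replaced by |x|^2 - r2: the term B B' goes to the
     quotient and - r2 B B' to the remainder. *)
  exists (fun x => A x * A' x + - (r2 x * (B x * B' x))),
    (fun x => A x * B' x + A' x * B x),
    (fun x => B x * B' x + (Q x * H x + (A x + x 0 e0 * B x) * Q' x)).
  have hH : polyf H.
    rewrite (_ : H = (fun x => A' x + x 0 e0 * B' x + dot x x * Q' x)); last exact/funext.
    do 2?apply: polyf_add => //; apply: polyf_mul => //; exact: polyf_coord.
  split; split.
  + apply: polyf_add; first exact: polyf_mul.
    by apply: polyf_opp; apply: polyf_mul => //; apply: polyf_mul.
  + by apply: polyf_add; apply: polyf_mul.
  + apply: polyf_add; first exact: polyf_mul.
    apply: polyf_add; apply: polyf_mul => //.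
    by apply: polyf_add => //; apply: polyf_mul => //; exact: polyf_coord.
  + by move=> x; rewrite iA iA' iB iB' /r2 /imq !mkqs.
  + by move=> x; rewrite iA iA' iB iB'.
  + by move=> x; rewrite E E' /r2 dotE; ring.
Qed.

(** On a line parallel to the real axis, |x|^2 becomes the monic quadratic t^2 + r2, while the left
    side has degree at most 1 in t; hence the quotient vanishes there. *)
Lemma polyf_divmod_uniq A B Q : (forall x, A (imq x) = A x) ->
  (forall x, B (imq x) = B x) -> polyf Q ->
  (forall x, A x + x 0 e0 * B x = dot x x * Q x) ->
  forall x, A x = 0 /\ B x = 0.
Proof.
move=> iA iB hQ E x.
have [p pE] := polyf_line (imq x) (mkq 1 0 0 0) hQ.
pose r2 := dot (imq x) (imq x).
have imE t : imq (imq x + t *: mkq 1 0 0 0) = imq x.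
  by apply: R4P; rewrite /imq !mxE /=; ring.
have pol : (A x)%:P + B x *: 'X = ('X^2 + r2%:P) * p.
  apply: poly_ext => t; rewrite !hornerE -pE.
  have := E (imq x + t *: mkq 1 0 0 0).
  rewrite -iA -iB imE iA iB.
  rewrite (_ : (imq x + t *: mkq 1 0 0 0) 0 e0 = t); last by rewrite /imq !mxE /=; ring.
  rewrite mulrC => ->; congr (_ * _).
  by rewrite /r2 !dotE /imq !mxE /=; ring.
have p0 : p = 0.
  apply/eqP/negPn/negP => pn0.
  have mon : ('X^2 + r2%:P : {poly R}) \is monic.
    apply/monicP; rewrite lead_coefDl ?lead_coefXn ?size_polyXn //.
    by rewrite ltnS (leq_trans (size_polyC_leq1 _)).
  have := congr1 (fun q : {poly R} => size q) pol.
  rewrite size_monicM // [size ('X^2 + _)]size_polyDl ?size_polyXn; last first.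
    by rewrite ltnS (leq_trans (size_polyC_leq1 _)).
  move=> sz; have : (size ((A x)%:P + B x *: 'X)%R <= 2)%N.
    apply: leq_trans (size_polyD _ _) _; rewrite geq_max.
    rewrite (leq_trans (size_polyC_leq1 _)) //=.
    by apply: leq_trans (size_scale_leq _ _) _; rewrite size_polyX.
  by rewrite sz addSn /= add2n ltnS ltnS leqNgt lt0n size_poly_eq0 pn0.
move: pol; rewrite p0 mulr0 => pol.
split.
  by have := congr1 (fun q : {poly R} => q`_0) pol; rewrite !coefE /= mulr0 addr0.
by have := congr1 (fun q : {poly R} => q`_1) pol; rewrite !coefE /= mulr1 add0r.
Qed.

(* The norm form A^2 + r^2 B^2 of the residue A + x0 B modulo |x|^2 is
   anisotropic over the reals, so |x|^2 is prime. *)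
Lemma dot_prime F G H : polyf F -> polyf G -> polyf H ->
  (forall x, F x * G x = dot x x * H x) ->
  (exists2 Q, polyf Q & forall x, F x = dot x x * Q x) \/
  (exists2 Q, polyf Q & forall x, G x = dot x x * Q x).
Proof.
move=> hF hG hH FG.
have [A [B [Q [[hA hB hQ] [iA iB E]]]]] := polyf_divmod hF.
have [C [D [Q' [[hC hD hQ'] [iC iD E']]]]] := polyf_divmod hG.
pose r2 (x : V) := dot (imq x) (imq x).
have r2E x : r2 x = x 0 e1 * x 0 e1 + x 0 e2 * x 0 e2 + x 0 e3 * x 0 e3.
  by rewrite /r2 dotE /imq !mkqs; ring.
(* The two components of the product of the remainders A + x0 B and C + x0 D, reduced by x0^2 = -
   r2; they vanish by uniqueness of the remainder. *)
have key x : A x * C x - r2 x * (B x * D x) = 0 /\ A x * D x + B x * C x = 0.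
  apply: (@polyf_divmod_uniq (fun x => A x * C x - r2 x * (B x * D x))
    (fun x => A x * D x + B x * C x)
    (fun x => H x + - (B x * D x + (Q x * G x + (A x + x 0 e0 * B x) * Q' x)))).
  - by move=> y; rewrite iA iC iB iD !r2E /imq !mkqs.
  - by move=> y; rewrite iA iC iB iD.
  - apply: polyf_add => //; apply: polyf_opp; apply: polyf_add; first exact: polyf_mul.
    apply: polyf_add; apply: polyf_mul => //.
    by apply: polyf_add => //; apply: polyf_mul => //; exact: polyf_coord.
  - move=> y /=; rewrite [RHS]mulrDr -FG E E' r2E !dotE; ring.
have pr2 : polyf r2.
  rewrite (_ : r2 = fun x => x 0 e1 * x 0 e1 + (x 0 e2 * x 0 e2 + x 0 e3 * x 0 e3)).
    by do 2?apply: polyf_add; apply: polyf_mul; exact: polyf_coord.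
  by apply/funext => x; rewrite r2E; ring.
(* N is the product of A + x0 B and its conjugate A - x0 B modulo |x|^2. Multiplying the relations
   of [key] by this conjugate isolates C N and D N. *)
pose N x := A x * A x + r2 x * (B x * B x).
have pN : polyf N by apply: polyf_add; apply: polyf_mul => //; apply: polyf_mul.
have CN x : C x * N x = 0.
  have [k1 k2] := key x; rewrite /N.
  have -> : C x * (A x * A x + r2 x * (B x * B x)) =
    A x * (A x * C x - r2 x * (B x * D x)) + r2 x * B x * (A x * D x + B x * C x) by ring.
  by rewrite k1 k2 !mulr0 addr0.
have DN x : D x * N x = 0.
  have [k1 k2] := key x; rewrite /N.
  have -> : D x * (A x * A x + r2 x * (B x * B x)) =
    A x * (A x * D x + B x * C x) - B x * (A x * C x - r2 x * (B x * D x)) by ring.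
  by rewrite k1 k2 !mulr0 subr0.
have N0F : (forall x, N x = 0) -> exists2 Q, polyf Q & forall x, F x = dot x x * Q x.
  move=> N0; exists Q => // x; rewrite E.
  have r0 y : 0 <= r2 y by rewrite r2E !addr_ge0 // -expr2 sqr_ge0.
  have A0 y : A y = 0.
    apply/eqP; have := N0 y; rewrite /N => /eqP; rewrite paddr_eq0.
    - by rewrite mulf_eq0 orbb => /andP[].
    - by rewrite -expr2 sqr_ge0.
    - by apply: mulr_ge0 => //; rewrite -expr2 sqr_ge0.
  have pB : forall y, r2 y * B y = 0.
    move=> y; apply/eqP; have := N0 y; rewrite /N A0 mulr0 add0r => /eqP.
    by rewrite !mulf_eq0 orbb.
  have [r20|B0] := polyf_integral pr2 hB pB; last by rewrite A0 B0 mulr0 !add0r.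
  have := r20 (mkq 0 1 0 0); rewrite r2E !mkqs => /eqP.
  by rewrite !mulr0 mulr1 !addr0 oner_eq0.
have [C0|/N0F] := polyf_integral hC pN CN; last by left.
have [D0|/N0F] := polyf_integral hD pN DN; last by left.
by right; exists Q' => // x; rewrite E' C0 D0 mulr0 !add0r.
Qed.

Lemma dot_ge0 (x : V) : 0 <= dot x x.
Proof. by apply: sumr_ge0 => i _; rewrite -expr2 sqr_ge0. Qed.

Lemma dot_eq0 (x : V) : (dot x x == 0) = (x == 0).
Proof.
apply/eqP/eqP => [/psumr_eq0P x0|->]; last by rewrite dotE !mxE; ring.
apply/rowP => i; have /eqP := x0 (fun i _ => sqr_ge0 (x 0 i)) i isT.
by rewrite mulf_eq0 orbb mxE => /eqP.
Qed.

(** A first-order expansion at 0. The order of quantifiers is the point: c and a serve all lines at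
    once, only the remainder p depends on x. *)
Lemma polyf_line0 Q : polyf Q -> exists (c : R) (a : V), forall x,
  exists p : {poly R}, forall t, Q (t *: x) = c + t * dot a x + t ^+ 2 * p.[t].
Proof.
elim=> [c|i|G H _ [c [a pE]] _ [d [b qE]]|G H _ [c [a pE]] _ [d [b qE]]].
- exists c, 0 => x; exists 0 => t; rewrite dotE !mxE horner0; ring.
- exists 0, (delta_mx 0 i) => x; exists 0 => t; rewrite horner0 mxE.
  rewrite mulr0 addr0 add0r; congr (_ * _); rewrite /dot (bigD1 i) //=.
  rewrite big1 ?addr0 ?mxE ?eqxx ?mul1r // => j ji; rewrite mxE eqxx /=.
  by rewrite (negbTE ji) mul0r.
- exists (c + d), (a + b) => x; have [p pt] := pE x; have [q qt] := qE x.
  by exists (p + q) => t; rewrite pt qt hornerD !dotE !mxE; ring.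
- exists (c * d), (c *: b + d *: a) => x; have [p pt] := pE x; have [q qt] := qE x.
  exists ((dot a x * dot b x)%:P + c *: q + d *: p
    + (dot a x *: q + dot b x *: p) * 'X + p * q * 'X * 'X) => t.
  by rewrite pt qt !hornerE !dotE !mxE; ring.
Qed.

(** Comparing degrees in t on the line through x gives Q(t x) = t Q(x), so Q agrees with its own
    first-order part. This is where the linear maps l and b of the overview come from. *)
Lemma cubic_quotient_linear F Q : hpolyf 3 F -> polyf Q ->
  (forall x, F x = dot x x * Q x) -> exists a : V, forall x, Q x = dot a x.
Proof.
move=> hF hQ FQ; have [c [a hca]] := polyf_line0 hQ.
have Qlin x t : x != 0 -> Q (t *: x) = t * Q x.
  move=> xn0; have [q qE] := polyf_line 0 x hQ.
  have s0 : dot x x != 0 by rewrite dot_eq0.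
  suff qX : q = Q x *: 'X.
    by have := qE t; rewrite add0r qX !hornerE mulrC.
  apply: (@mulfI _ ('X^2 * (dot x x)%:P)).
    by rewrite mulf_neq0 // ?polyC_eq0 // expf_neq0 // polyX_eq0.
  apply: poly_ext => u; rewrite !(hornerM, hornerXn, hornerC, hornerZ, hornerX).
  have := hpolyfZ u x hF; rewrite !FQ -qE add0r.
  have -> : dot (u *: x) (u *: x) = u ^+ 2 * dot x x by rewrite !dotE !mxE; ring.
  by move=> ->; ring.
have Qa x : x != 0 -> Q x = dot a x /\ c = 0.
  move=> xn0; have [p pE] := hca x.
  have pol : c%:P + dot a x *: 'X + 'X^2 * p = Q x *: 'X.
    by apply: poly_ext => t; have := pE t; rewrite Qlin //
      !(hornerD, hornerM, hornerXn, hornerC, hornerZ, hornerX); lra.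
  split.
    have := congr1 (fun q : {poly R} => q`_1) pol.
    by rewrite !coefE /= !mulr1 add0r addr0 => ->.
  by have := congr1 (fun q : {poly R} => q`_0) pol; rewrite !coefE /= !mulr0 !addr0.
exists a => x; have [->|xn0] := eqVneq x 0; last by have [] := Qa _ xn0.
(* At x = 0 no division by |x|^2 is possible; the constant term c is shown to vanish by means of
   another, nonzero vector. *)
have o : (mkq 1 0 0 0 : V) != 0.
  by apply/eqP => /(congr1 (fun y : V => y 0 e0)); rewrite mkqs mxE => /eqP; rewrite oner_eq0.
have [_ c0] := Qa _ o; have [p pE] := hca 0; have := pE 0; rewrite scaler0 => ->.
by rewrite c0 !dotE !mxE; ring.
Qed.

End PolynomialFunctions.

(** * Quaternions and divisibility *)

Section QuadricDivisibility.
Variable R : realType.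
Local Notation V := (R4 R).

Definition sdvd (F : V -> R) : Prop :=
  exists2 Q, polyf Q & forall x, F x = dot x x * Q x.

Lemma coord_not_sdvd : ~ sdvd (fun x => x 0 e0).
Proof.
case=> Q hQ E; have [p pE] := polyf_line 0 (mkq 1 0 0 0) hQ.
have pol : 'X = 'X^2 * p.
  apply: poly_ext => t; rewrite !(hornerM, hornerXn, hornerX) -pE add0r.
  by have := E (t *: mkq 1 0 0 0); rewrite !dotE !mxE /= => E'; lra.
have := congr1 (fun q : {poly R} => q`_1) pol; rewrite coefX coefXnM /= => /eqP.
by rewrite oner_eq0.
Qed.

(** Vector identities are used through their coordinate 0, which leaves a factor v0; primality
    removes it. *)
Lemma sdvd_mul_coord F : polyf F -> sdvd (fun x => F x * x 0 e0) -> sdvd F.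
Proof.
move=> hF [H hH E]; have [//|c] := dot_prime hF (polyf_coord R e0) hH E.
by case: coord_not_sdvd.
Qed.

Lemma sdvd_sq F : polyf F -> sdvd (fun x => F x * F x) -> sdvd F.
Proof. by move=> hF [H hH E]; case: (dot_prime hF hF hH E). Qed.

End QuadricDivisibility.

Lemma hpolyf_addE (R : realType) d e (F G : R4 R -> R) :
  hpolyf d F -> hpolyf e G -> d = e -> hpolyf d (fun x => F x + G x).
Proof. by move=> hF hG de; apply: hpolyf_add => //; rewrite de. Qed.

Lemma hpolyf_deg (R : realType) d e (F : R4 R -> R) :
  hpolyf d F -> d = e -> hpolyf e F.
Proof. by move=> hF <-. Qed.

Lemma hpolyf_at0 (R : realType) d (F : R4 R -> R) : hpolyf d.+1 F -> F 0 = 0.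
Proof. by move=> hF; rewrite -[0 in LHS](scale0r 0) (hpolyfZ _ _ hF) expr0n mul0r. Qed.

(** Degrees are left as existential variables and built up bottom-up as sums; equality of degrees is
    then settled by computation, in sums and against the goal. *)
Ltac hpoly_rec :=
  lazymatch goal with
  | |- hpolyf _ (fun x => @?F x + @?G x) =>
      eapply hpolyf_addE; [hpoly_rec | hpoly_rec | reflexivity]
  | |- hpolyf _ (fun x => - @?F x) => eapply hpolyf_opp; hpoly_rec
  | |- hpolyf _ (fun x => @?F x * @?G x) =>
      eapply hpolyf_mul; [hpoly_rec | hpoly_rec]
  | |- hpolyf _ (fun x => dot _ _) =>
      eapply hpolyf_dot; [intro; hpoly_rec | intro; hpoly_rec]
  | |- _ => first [eassumption | eapply hpolyf_coord
      | match goal with H : forall i, hpolyf _ _ |- _ => eapply H end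
      | eapply hpolyf_cst]
  end.
Ltac hpoly := eapply hpolyf_deg; [hpoly_rec | reflexivity].

Section Quaternions.
Variable R : realType.
Local Notation V := (R4 R).
Local Notation "x ** y" := (qmul x y) (at level 40, left associativity).

Lemma hpolyf_qmul d e (X Y : V -> V) : (forall i, hpolyf d (fun x => X x 0 i)) ->
  (forall i, hpolyf e (fun x => Y x 0 i)) ->
  forall i, hpolyf (d + e) (fun x => (X x ** Y x) 0 i).
Proof.
move=> hX hY; apply: ord4P; under eq_fun do rewrite /qmul !mkqs;
  do 3?[apply: hpolyf_add|apply: hpolyf_opp|apply: hpolyf_mul] => //;
  do 3?[apply: hpolyf_add|apply: hpolyf_opp|apply: hpolyf_mul] => //.
Qed.

Lemma hpolyf_qconj d (X : V -> V) : (forall i, hpolyf d (fun x => X x 0 i)) ->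
  forall i, hpolyf d (fun x => qconj (X x) 0 i).
Proof.
move=> hX; apply: ord4P; under eq_fun do rewrite /qconj !mkqs; rewrite //;
  exact: hpolyf_opp.
Qed.

Definition qunit (i : 'I_4) : V := delta_mx 0 i.

Lemma qunitMl (v : V) : [/\ qunit e1 ** v = mkq (- v 0 e1) (v 0 e0) (- v 0 e3) (v 0 e2),
  qunit e2 ** v = mkq (- v 0 e2) (v 0 e3) (v 0 e0) (- v 0 e1) &
  qunit e3 ** v = mkq (- v 0 e3) (- v 0 e2) (v 0 e1) (v 0 e0)].
Proof. by split; rewrite /qmul !mxE /=; congr mkq; ring. Qed.

Lemma qunitMr (v : V) : [/\ v ** qunit e1 = mkq (- v 0 e1) (v 0 e0) (v 0 e3) (- v 0 e2),
  v ** qunit e2 = mkq (- v 0 e2) (- v 0 e3) (v 0 e0) (v 0 e1) &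
  v ** qunit e3 = mkq (- v 0 e3) (v 0 e2) (- v 0 e1) (v 0 e0)].
Proof. by split; rewrite /qmul !mxE /=; congr mkq; ring. Qed.

(** When <v, w> = 0 and |v|^2 divides |w|^2, every term on the right is a multiple of |v|^2. The
    unit 1 is excluded from a and b because coordinate 0 of either product is just <v, w>. *)
Lemma qmul_conj_coef (v w : V) (a b : 'I_4) : a != e0 -> b != e0 ->
  2 * ((w ** qconj v) 0 a * (qconj v ** w) 0 b) =
  2 * dot v w * dot (qunit a ** v ** qunit b) w
  - dot w w * dot (qunit a ** v ** qunit b) v
  - dot v v * dot (qunit a ** w ** qunit b) w.
Proof.
have L1 x := let: And3 h _ _ := qunitMl x in h.
have L2 x := let: And3 _ h _ := qunitMl x in h.
have L3 x := let: And3 _ _ h := qunitMl x in h.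
have M1 x := let: And3 h _ _ := qunitMr x in h.
have M2 x := let: And3 _ h _ := qunitMr x in h.
have M3 x := let: And3 _ _ h := qunitMr x in h.
move: a b; apply: ord4P => // + _; apply: ord4P => // _;
  rewrite ?(L1, L2, L3) ?(M1, M2, M3) !dotE /qmul /qconj !mkqs;
  move: (v 0 e0) (v 0 e1) (v 0 e2) (v 0 e3) (w 0 e0) (w 0 e1) (w 0 e2) (w 0 e3)
    => v0 v1 v2 v3 w0 w1 w2 w3; ring.
Qed.

Lemma qmul_conjK (v w : V) : w ** qconj v ** v = dot v v *: w.
Proof. by apply: R4P; rewrite dotE /qmul /qconj !mkqs !mxE /=; ring. Qed.

Lemma qconj_mulK (v w : V) : v ** (qconj v ** w) = dot v v *: w.
Proof. by apply: R4P; rewrite dotE /qmul /qconj !mkqs !mxE /=; ring. Qed.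

Lemma qmulZl c (v w : V) : (c *: v) ** w = c *: (v ** w).
Proof. by apply: R4P; rewrite /qmul !mkqs !mxE /=; ring. Qed.

Lemma qmulZr c (v w : V) : v ** (c *: w) = c *: (v ** w).
Proof. by apply: R4P; rewrite /qmul !mkqs !mxE /=; ring. Qed.

Lemma qmul0x (w : V) : 0 ** w = 0.
Proof. by rewrite -[0 in LHS](scale0r 0) qmulZl scale0r. Qed.

Lemma qmulx0 (w : V) : w ** 0 = 0.
Proof. by rewrite -[0 in LHS](scale0r 0) qmulZr scale0r. Qed.

Lemma dot_mulmx (a : 'I_4 -> V) (v : V) i :
  dot (a i) v = (v *m (\matrix_(j, k) a k 0 j)) 0 i.
Proof. by rewrite mxE /dot; apply: eq_bigr => j _; rewrite !mxE mulrC. Qed.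

(** From |v|^2 w = (w conj(v)) v = v (conj(v) w), it suffices that all coordinates of one of the two
    products be divisible by |v|^2; the quotients are then linear and form the matrix M. *)
Lemma isotropic_quadratic_map (w : V -> V) :
  (forall i, hpolyf 2 (fun v => w v 0 i)) -> (forall v, dot v (w v) = 0) ->
  sdvd (fun v => dot (w v) (w v)) ->
  exists M : 'M[R]_4, (forall v, w v = (v *m M) ** v) \/ (forall v, w v = v ** (v *m M)).
Proof.
move=> hw vw [N hN wN].
have hx i : hpolyf 1 (fun x : V => x 0 i) by exact: hpolyf_coord.
pose p v := w v ** qconj v; pose q v := qconj v ** w v.
have hp : forall i, hpolyf 3 (fun v => p v 0 i).
  by apply: (@hpolyf_qmul 2 1) => // i; apply: hpolyf_qconj.
have hq : forall i, hpolyf 3 (fun v => q v 0 i).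
  by apply: (@hpolyf_qmul 1 2) => // i; apply: hpolyf_qconj.
have p0 v : p v 0 e0 = 0.
  by rewrite /p /qmul /qconj !mkqs -(vw v) dotE; ring.
have q0 v : q v 0 e0 = 0.
  by rewrite /q /qmul /qconj !mkqs -(vw v) dotE; ring.
have triv (F : V -> R) : (forall v, F v = 0) -> sdvd F.
  by move=> F0; exists (fun=> 0) => [|v]; [exact: polyf_cst|rewrite F0 mulr0].
have pq a b : sdvd (fun v => p v 0 a) \/ sdvd (fun v => q v 0 b).
  have [->|a0] := eqVneq a e0; first by left; apply: triv.
  have [->|b0] := eqVneq b e0; first by right; apply: triv.
  have hc i j : hpolyf 0 (fun=> qunit i 0 j) by exact: hpolyf_cst.
  have hv2 : hpolyf 2 (fun v => dot (qunit a ** v ** qunit b) v).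
    apply: (@hpolyf_dot _ 1 1) => // i.
    by apply: (@hpolyf_qmul 1 0) => // j; apply: (@hpolyf_qmul 0 1) => // k.
  have hw2 : hpolyf 4 (fun v => dot (qunit a ** w v ** qunit b) (w v)).
    apply: (@hpolyf_dot _ 2 2) => // i.
    by apply: (@hpolyf_qmul 2 0) => // j; apply: (@hpolyf_qmul 0 2) => // k.
  apply: (@dot_prime _ _ _ (fun v => - 2^-1 * (N v * dot (qunit a ** v ** qunit b) v
      + dot (qunit a ** w v ** qunit b) (w v)))).
  - exact: hpolyf_polyf (hp a).
  - exact: hpolyf_polyf (hq b).
  - apply: polyf_mul; first exact: polyf_cst.
    apply: polyf_add; last exact: hpolyf_polyf hw2.
    by apply: polyf_mul => //; exact: hpolyf_polyf hv2.
  - move=> v; have := @qmul_conj_coef v (w v) a b a0 b0; rewrite vw wN /= => E.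
    by apply: (@mulfI _ 2) => //; rewrite /p /q E; field.
(* If a single coordinate j of p is not divisible, the alternatives [pq j b] force every coordinate
   of q to be divisible: this turns a choice for each pair of coordinates into one global choice. *)
have [sp|/existsNP [j sp]] := pselect (forall a, sdvd (fun v => p v 0 a)).
  have /choice [c cE] : forall i, exists a : V, forall v, p v 0 i = dot v v * dot a v.
    move=> i; have [Q hQ QE] := sp i; have [x xE] := cubic_quotient_linear (hp i) hQ QE.
    by exists x => v; rewrite QE xE.
  exists (\matrix_(j, k) c k 0 j); left => v.
  have [->|v0] := eqVneq v 0.
    rewrite qmulx0; apply/rowP => i; rewrite mxE; exact: (hpolyf_at0 (hw i)).
  have s0 : dot v v != 0 by rewrite dot_eq0.
  apply: (scalerI s0); rewrite -qmul_conjK -qmulZl; congr (_ ** _).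
  by apply/rowP => i; rewrite -[LHS]/(p v 0 i) cE mxE dot_mulmx.
have sq b : sdvd (fun v => q v 0 b) by case: (pq j b).
have /choice [c cE] : forall i, exists a : V, forall v, q v 0 i = dot v v * dot a v.
  move=> i; have [Q hQ QE] := sq i; have [x xE] := cubic_quotient_linear (hq i) hQ QE.
  by exists x => v; rewrite QE xE.
exists (\matrix_(j, k) c k 0 j); right => v.
have [->|v0] := eqVneq v 0.
  rewrite qmul0x; apply/rowP => i; rewrite mxE; exact: (hpolyf_at0 (hw i)).
have s0 : dot v v != 0 by rewrite dot_eq0.
apply: (scalerI s0); rewrite -qconj_mulK -qmulZr; congr (_ ** _).
by apply/rowP => i; rewrite -[LHS]/(q v 0 i) cE mxE dot_mulmx.
Qed.

End Quaternions.

(** * Divisibility by |v|^2 extracted from the Taylor coefficients *)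

Section JetAlgebra.
Variable R : realType.
Local Notation V := (R4 R).

Lemma dotC (x y : V) : dot x y = dot y x.
Proof. by rewrite !dotE; ring. Qed.

Lemma dotZl c (x y : V) : dot (c *: x) y = c * dot x y.
Proof. by rewrite !dotE !mxE; ring. Qed.

Lemma dotZr c (x y : V) : dot x (c *: y) = c * dot x y.
Proof. by rewrite !dotE !mxE; ring. Qed.

Lemma dotDl (x y z : V) : dot (x + y) z = dot x z + dot y z.
Proof. by rewrite !dotE !mxE; ring. Qed.

Lemma dotDr (x y z : V) : dot z (x + y) = dot z x + dot z y.
Proof. by rewrite !dotE !mxE; ring. Qed.

(* The hypotheses on [D] are the Taylor coefficients of orders 2, 3 and 4 of
   |v|^2 x = <x, v> v + |v|^2 |x|^2 k along x = t v + t^2 G2 + t^3 G3 + .... *)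
Lemma quaternionic_second_jet (D : V -> Prop) (G2 G3 G4 : V -> V) :
  (forall d F, hpolyf d F -> (forall v, D v -> F v = 0) -> forall v, F v = 0) ->
  (forall i, hpolyf 2 (fun v => G2 v 0 i)) ->
  (forall i, hpolyf 3 (fun v => G3 v 0 i)) ->
  (forall i, hpolyf 4 (fun v => G4 v 0 i)) ->
  (forall v, D v -> exists k, let s := dot v v in
    [/\ s *: G2 v = dot (G2 v) v *: v + (s * s) *: k,
        s *: G3 v = dot (G3 v) v *: v + (2 * dot v (G2 v) * s) *: k &
        s *: G4 v = dot (G4 v) v *: v
          + ((dot (G2 v) (G2 v) + 2 * dot v (G3 v)) * s) *: k]) ->
  exists (w : V -> V) (M : 'M[R]_4), [/\ forall v, dot v (w v) = 0,
    forall v, dot v v *: G2 v = dot (G2 v) v *: v + dot v v *: w v &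
    (forall v, w v = qmul (v *m M) v) \/ (forall v, w v = qmul v (v *m M))].
Proof.
move=> dens h2 h3 h4 hD.
have hx i : hpolyf 1 (fun x : V => x 0 i) by exact: hpolyf_coord.
have hs : hpolyf 2 (fun v : V => dot v v) by hpoly.
have ps := hpolyf_polyf hs.
have hg2 : hpolyf 3 (fun v => dot v (G2 v)) by hpoly.
have hg3 : hpolyf 4 (fun v => dot v (G3 v)) by hpoly.
have s0 (v : V) : v != 0 -> dot v v != 0 by rewrite dot_eq0.
(* The order 3 identity multiplied by |v|^2, with |v|^4 k replaced by its value from order 2. This
   eliminates k, so the identity spreads from D to all v. *)
have E3 i v : dot v v * dot v v * G3 v 0 i - dot v v * dot v (G3 v) * v 0 i
    - 2 * dot v (G2 v) * (dot v v * G2 v 0 i - dot v (G2 v) * v 0 i) = 0.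
  move: v; apply: (dens 7) => [|v Dv]; first by hpoly.
  have [k [k2 k3 _]] := hD v Dv.
  have := congr1 (fun x : V => x 0 i) k2; have := congr1 (fun x : V => x 0 i) k3.
  rewrite !mxE (dotC (G2 v)) (dotC (G3 v)) => k3i k2i.
  rewrite -mulrA k3i k2i; ring.
(* Modulo |v|^2, [E3] at coordinate 0 reads 2 <v, G2>^2 v0 = 0. *)
have [l hl lE] : sdvd (fun v => dot v (G2 v)).
  apply: sdvd_sq; first exact: hpolyf_polyf hg2.
  apply: sdvd_mul_coord; first by apply: polyf_mul; exact: hpolyf_polyf hg2.
  exists (fun v => 2^-1 * (- (dot v v * G3 v 0 e0) + dot v (G3 v) * v 0 e0
    + 2 * dot v (G2 v) * G2 v 0 e0)) => [|v].
    by apply: (@hpolyf_polyf _ 5); hpoly.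
  apply: (@mulfI _ 2) => //; have := E3 e0 v => E; apply/eqP; rewrite -subr_eq0.
  by rewrite -E; apply/eqP; field.
have [a aE] := cubic_quotient_linear hg2 hl lE.
have hlin : hpolyf 1 l.
  apply: (@hpolyf_ext _ _ _ (fun v => dot a v)) => [v|]; first by rewrite aE.
  by apply: (@hpolyf_dot _ 0 1) => // i; exact: hpolyf_cst.
pose w v := G2 v - l v *: v.
have hw i : hpolyf 2 (fun v => w v 0 i).
  apply: (@hpolyf_ext _ _ _ (fun v => G2 v 0 i - l v * v 0 i)) => [v|]; last by hpoly.
  by rewrite !mxE.
have vw v : dot v (w v) = 0.
  by rewrite /w dotDr lE -scaleNr dotZr; ring.
have G2E v : G2 v = l v *: v + w v by rewrite /w addrC subrK.
have E3' i v : dot v v * G3 v 0 i = dot v (G3 v) * v 0 i + 2 * l v * dot v v * w v 0 i.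
  have [->|v0] := eqVneq v 0; first by rewrite !dotE !mxE; ring.
  apply: (mulfI (s0 _ v0)); have := E3 i v; rewrite lE => E.
  by apply/eqP; rewrite -subr_eq0 -E /w !mxE; apply/eqP; ring.
have [q hq qE] : sdvd (fun v => dot v (G3 v)).
  apply: sdvd_mul_coord; first exact: hpolyf_polyf hg3.
  exists (fun v => G3 v 0 e0 - 2 * l v * w v 0 e0) => [|v].
    by apply: (@hpolyf_polyf _ 3); hpoly.
  have := E3' e0 v => E; rewrite mulrBr E; ring.
have hg4 : hpolyf 5 (fun v => dot v (G4 v)) by hpoly.
(* Here k is eliminated through w = |v|^2 k, which holds on D now that the tangential part l(v) v
   has been split off. *)
have E4 i v : dot v v * G4 v 0 i - dot v (G4 v) * v 0 i
    - (dot (G2 v) (G2 v) + 2 * dot v (G3 v)) * w v 0 i = 0.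
  move: v; apply: (dens 6) => [|v Dv]; first by hpoly.
  have [->|v0] := eqVneq v 0.
    have -> : w 0 0 i = 0 by exact: (hpolyf_at0 (hw i)).
    by rewrite dotE !mxE; ring.
  have [k [k2 _ k4]] := hD v Dv.
  have wk : w v = dot v v *: k.
    apply: (scalerI (s0 _ v0)); rewrite /w scalerBr k2 (dotC (G2 v)) lE !scalerA.
    by rewrite addrC addKr.
  have := congr1 (fun x : V => x 0 i) k4; rewrite wk !mxE (dotC (G4 v)) => ->; ring.
(* Pairing the order 4 identity with w kills the term along v. Substituting |G2|^2 = l^2 |v|^2 +
   |w|^2 and <v, G3> = |v|^2 q leaves |w|^4 as a multiple of |v|^2. *)
have [N hN wN] : sdvd (fun v => dot (w v) (w v)).
  have hww : hpolyf 4 (fun v => dot (w v) (w v)) by hpoly.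
  apply: sdvd_sq; first exact: hpolyf_polyf hww.
  exists (fun v => dot (w v) (G4 v) - (l v * l v + 2 * q v) * dot (w v) (w v)) => [|v].
    apply: polyf_add; first by apply: (@hpolyf_polyf _ 6); hpoly.
    apply: polyf_opp; apply: polyf_mul; last exact: hpolyf_polyf hww.
    by apply: polyf_add; apply: polyf_mul => //; exact: polyf_cst.
  have W4 : dot v v * dot (w v) (G4 v) =
      (dot (G2 v) (G2 v) + 2 * dot v (G3 v)) * dot (w v) (w v).
    have : dot v v *: G4 v = dot v (G4 v) *: v
        + (dot (G2 v) (G2 v) + 2 * dot v (G3 v)) *: w v.
      apply/rowP => i; have := E4 i v; move: (w v) => wv E; rewrite !mxE.
      by apply/eqP; rewrite -subr_eq0 -E; apply/eqP; ring.
    move/(congr1 (dot (w v))); rewrite dotDr !dotZr (dotC (w v) v) vw => ->; ring.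
  have G22 : dot (G2 v) (G2 v) = l v * l v * dot v v + dot (w v) (w v).
    have := G2E v; move: (w v) (vw v) => wv vwv ->.
    by rewrite !dotDl !dotDr !dotZl !dotZr (dotC wv v) vwv; ring.
  by move: W4; rewrite G22 qE => W4; rewrite mulrBr W4; ring.
have [M HM] := isotropic_quadratic_map hw vw (ex_intro2 _ _ N hN wN).
exists w, M; split=> // v.
have := G2E v; move: (w v) (vw v) => wv vwv ->.
by rewrite dotDl dotZl (dotC wv) vwv addr0 scalerDr !scalerA mulrC.
Qed.

End JetAlgebra.

(** * Differentiability from directional derivatives *)

Section SmoothMaps.
Variable R : realType.
Local Notation V := (R4 R).

Lemma norm_rV4_le (x : V) (r : R) : 0 <= r ->
  (forall i, `|x 0 i| <= r) -> `|x| <= r.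
Proof.
move=> r0 xr; rewrite [`|x|]mx_normrE; apply: bigmax_le => // -[i j] _ /=.
by rewrite ord1.
Qed.

Lemma coord_le_norm (x : V) i : `|x 0 i| <= `|x|.
Proof. by rewrite [leRHS]mx_normrE; exact: (le_bigmax _ _ (0, i)). Qed.

Lemma continuous_rV4 (T : topologicalType) (f : T -> V) x :
  (forall i, {for x, continuous (fun y => f y 0 i)}) -> {for x, continuous f}.
Proof.
move=> fi; apply/cvgrPdist_le => e e0.
near=> y; apply: norm_rV4_le => [|i]; first exact: ltW.
rewrite !mxE; move: i; near: y; apply: filter_forall => i.
by have /cvgrPdist_le/(_ e e0) := fi i.
Unshelve. all: by end_near. Qed.

Lemma mulmx_continuous (A : 'M[R]_4) : continuous (fun y : V => y *m A).
Proof.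
move=> x; apply: continuous_rV4 => i.
rewrite (_ : (fun y => _) = (fun y : V => \sum_j y 0 j * A j i)); last first.
  by apply/funext => y; rewrite mxE.
apply: continuous_big => [|j _]; first exact: add_continuous.
by move=> y; apply: continuousM; [exact: coord_continuous|exact: cst_continuous].
Qed.

Lemma is_derive_coord (T : normedModType R) (f : T -> V) (x v : T) df i :
  is_derive x v f df -> is_derive x v (fun y => f y 0 i) (df 0 i).
Proof.
move=> [fd <-]; apply: DeriveDef; first by have /derivable_mxP := fd; apply.
by rewrite derive_mx // mxE.
Qed.

Lemma is_derive_line (f : V -> V) (z v : V) t : derivable f (z + t *: v) v ->
  is_derive t 1 (fun u : R => f (z + u *: v)) ('D_v f (z + t *: v)).
Proof.
have E : (fun h : R => h^-1 *: (((fun u : R => f (z + u *: v)) \o shift t) (h *: 1)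
      - f (z + t *: v))) =
    (fun h : R => h^-1 *: ((f \o shift (z + t *: v)) (h *: v) - f (z + t *: v))).
  apply/funext => h /=; congr (_ *: (f _ - _)).
  by rewrite [h *: 1]mulr1 scalerDl addrCA.
by move=> df; apply: DeriveDef; rewrite /derivable /derive E.
Qed.

Lemma mean_value_sym (f df : R -> R) (a : R) :
  (forall t : R, `|t| <= `|a| -> is_derive t 1 f (df t)) ->
  exists2 c, `|c| <= `|a| & f a - f 0 = df c * a.
Proof.
move=> fd.
have cont (b c : R) : (forall t, b <= t <= c -> `|t| <= `|a|) ->
    {within `[b, c], continuous f}.
  move=> bc; apply: derivable_within_continuous => t; rewrite in_itv /= => /bc /fd.
  by case.
have [a0|a0] := leP 0 a.
  have itv t : 0 <= t <= a -> `|t| <= `|a|.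
    by move=> /andP[t0 ta]; rewrite !ger0_norm.
  have fd' t : t \in `]0, a[%R -> is_derive t 1 f (df t).
    by rewrite in_itv /= => /andP[/ltW t0 /ltW ta]; apply/fd/itv; rewrite t0.
  have [c] := MVT_segment a0 fd' (cont _ _ itv).
  by rewrite in_itv /= subr0 => /itv ca ->; exists c.
have itv t : a <= t <= 0 -> `|t| <= `|a|.
  by move=> /andP[ta t0]; rewrite !ler0_norm ?(ltW a0) // lerN2.
have fd' t : t \in `]a, 0[%R -> is_derive t 1 f (df t).
  by rewrite in_itv /= => /andP[/ltW ta /ltW t0]; apply/fd/itv; rewrite ta.
have [c] := MVT_segment (ltW a0) fd' (cont _ _ itv).
by rewrite in_itv /= => /itv ca E; exists c => //; rewrite -opprB E sub0r mulrN opprK.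
Qed.

Lemma diff_of_estimate (f : V -> V) (A : 'M[R]_4) (x : V) :
  (forall e, 0 < e -> \forall y \near (0 : V),
     `|f (y + x) - (f x + y *m A)| <= e * `|y|) ->
  differentiable f x /\ forall v, 'd f x v = v *m A.
Proof.
move=> est.
have cA : continuous (mulmxr A : V -> V) by exact: mulmx_continuous.
have dE : 'd f x = (mulmxr A : {linear V -> V}) :> (V -> V).
  by apply: diff_unique => //; apply/eqaddoP => e e0; exact: est.
split; last by move=> v; rewrite dE.
apply/diff_locallyP; rewrite dE; split=> //.
by apply/eqaddoP => e e0; exact: est.
Qed.

(** The classical argument: move from x to x + y one coordinate at a time, apply the mean value
    theorem to each of the four increments, and compare with the partial derivatives at x. Each
    increment costs at most (e / 4) |y|. *)
Lemma C1_differentiable (W : set V) (f : V -> V) (x : V) : open W -> W x ->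
  (forall y v, W y -> derivable f y v) ->
  (forall v, {for x, continuous ('D_v f)}) ->
  differentiable f x.
Proof.
move=> oW Wx fd Dc.
pose d i : V := delta_mx 0 i.
pose A : 'M[R]_4 := \matrix_(j, i) 'D_(d j) f x 0 i.
suff [] : differentiable f x /\ forall v, 'd f x v = v *m A by [].
apply: diff_of_estimate => e epos.
have e4 : 0 < e / 4 by rewrite divr_gt0.
have : \forall z \near x, W z /\ forall j, `|'D_(d j) f x - 'D_(d j) f z| <= e / 4.
  near=> z; split; first by near: z; exact: open_nbhs_nbhs.
  move=> j; move: j; near: z; apply: filter_forall => j.
  by have /cvgrPdist_le/(_ _ e4) := Dc (d j).
move=> /nbhs_ballP [r /= r0 xr].
near=> y.
have yr : `|y| < r.
  by near: y; apply/nbhs_ballP; exists r => //= y; rewrite -ball_normE /= sub0r normrN.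
have inr (z : V) : (forall i, `|z 0 i| <= `|y|) ->
    W (z + x) /\ forall j, `|'D_(d j) f x - 'D_(d j) f (z + x)| <= e / 4.
  move=> zy; apply: xr; rewrite -ball_normE /= opprD addrCA subrr addr0 normrN.
  by apply: le_lt_trans yr; exact: norm_rV4_le.
have step (z : V) j i : (forall k, `|z 0 k| <= `|y|) -> z 0 j = 0 ->
    `|f (z + y 0 j *: d j + x) 0 i - f (z + x) 0 i - y 0 j * A j i| <= e / 4 * `|y|.
  move=> zy zj.
  have inz t : `|t| <= `|y 0 j| -> forall k, `|(z + t *: d j) 0 k| <= `|y|.
    move=> ty k; rewrite !mxE eqxx /=.
    have [->|_] := eqVneq k j; last by rewrite mulr0 addr0.
    by rewrite zj add0r mulr1 (le_trans ty) // coord_le_norm.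
  have dl (t : R) : `|t| <= `|y 0 j| -> is_derive t 1
      (fun u : R => f (z + x + u *: d j) 0 i) ('D_(d j) f (z + x + t *: d j) 0 i).
    move=> ty; apply: is_derive_coord; apply: is_derive_line; apply: fd.
    by rewrite addrAC; have [] := inr _ (inz t ty).
  have [c cy] := mean_value_sym dl.
  rewrite scale0r addr0 addrAC => E.
  rewrite E mulrC -mulrBr normrM mulrC; apply: ler_pM => //.
    have [_ /(_ j)] := inr _ (inz c cy); rewrite addrAC => H; apply: le_trans H.
    rewrite -normrN opprB; apply: le_trans (coord_le_norm _ i).
    by rewrite !mxE.
  exact: coord_le_norm.
apply: norm_rV4_le => [|i]; first by rewrite mulr_ge0 // ltW.
have y0 k : `|y 0 k| <= `|y| := coord_le_norm y k.
pose z1 := mkq (y 0 e0) 0 0 0; pose z2 := mkq (y 0 e0) (y 0 e1) 0 0.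
pose z3 := mkq (y 0 e0) (y 0 e1) (y 0 e2) 0.
have n0 : `|0 : R| <= `|y| by rewrite normr0.
have H0 : `|f (z1 + x) 0 i - f (0 + x) 0 i - y 0 e0 * A e0 i| <= e / 4 * `|y|.
  rewrite (_ : z1 = 0 + y 0 e0 *: d e0); first by apply: step => [k|]; rewrite mxE.
  by apply: R4P; rewrite !mxE /=; ring.
have H1 : `|f (z2 + x) 0 i - f (z1 + x) 0 i - y 0 e1 * A e1 i| <= e / 4 * `|y|.
  rewrite (_ : z2 = z1 + y 0 e1 *: d e1).
    by apply: step; [apply: ord4P; rewrite mkqs|rewrite mkqs].
  by apply: R4P; rewrite !mxE /=; ring.
have H2 : `|f (z3 + x) 0 i - f (z2 + x) 0 i - y 0 e2 * A e2 i| <= e / 4 * `|y|.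
  rewrite (_ : z3 = z2 + y 0 e2 *: d e2).
    by apply: step; [apply: ord4P; rewrite mkqs|rewrite mkqs].
  by apply: R4P; rewrite !mxE /=; ring.
have H3 : `|f (y + x) 0 i - f (z3 + x) 0 i - y 0 e3 * A e3 i| <= e / 4 * `|y|.
  rewrite {1}(_ : y = z3 + y 0 e3 *: d e3).
    by apply: step; [apply: ord4P; rewrite mkqs|rewrite mkqs].
  by apply: R4P; rewrite !mxE /=; ring.
have -> : (f (y + x) - (f x + y *m A)) 0 i =
  (f (z1 + x) 0 i - f (0 + x) 0 i - y 0 e0 * A e0 i) +
  (f (z2 + x) 0 i - f (z1 + x) 0 i - y 0 e1 * A e1 i) +
  (f (z3 + x) 0 i - f (z2 + x) 0 i - y 0 e2 * A e2 i) +
  (f (y + x) 0 i - f (z3 + x) 0 i - y 0 e3 * A e3 i).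
  have mA : (y *m A) 0 i = y 0 e0 * A e0 i + y 0 e1 * A e1 i + y 0 e2 * A e2 i + y 0 e3 * A e3 i.
    by rewrite [LHS]mxE sum4.
  have sub (u v w : V) : (u - (v + w)) 0 i = u 0 i - v 0 i - w 0 i.
    by rewrite !mxE opprD addrA.
  rewrite sub mA add0r; move: (f (z1 + x) 0 i) (f (z2 + x) 0 i) (f (z3 + x) 0 i).
  move: (f (y + x) 0 i) (f x 0 i) (A e0 i) (A e1 i) (A e2 i) (A e3 i) => *; ring.
apply: le_trans (ler_normD _ _) _; apply: le_trans (lerD (ler_normD _ _) H3) _.
apply: le_trans (lerD (lerD (ler_normD _ _) H2) (lexx _)) _.
apply: le_trans (lerD (lerD (lerD H0 H1) (lexx _)) (lexx _)) _.
by rewrite le_eqVlt; apply/orP; left; apply/eqP; field.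
Unshelve. all: by end_near. Qed.

End SmoothMaps.

(** * Iterated derivatives as homogeneous polynomials in the direction *)

Section IteratedDerivatives.
Variable R : realType.
Local Notation V := (R4 R).
Implicit Types (U : set V) (f g : V -> V).

Lemma iter_dir_rcons vs v f : iter_dir (rcons vs v) f = iter_dir vs ('D_v f).
Proof. by elim: vs => //= w vs ->. Qed.

Lemma smooth_on_derive U f v : smooth_on U f -> smooth_on U ('D_v f).
Proof. by move=> sf vs x Ux; rewrite -iter_dir_rcons; exact: sf. Qed.

Lemma smooth_on_differentiable U f x : open U -> smooth_on U f -> U x ->
  differentiable f x.
Proof.
move=> oU sf Ux; apply: (C1_differentiable oU Ux) => [y v Uy|v].
  by have [_] := sf [::] y Uy; apply.
by have [] := sf [:: v] x Ux.
Qed.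

Lemma iter_dir_eq_on U f g vs : open U -> {in U, f =1 g} ->
  {in U, iter_dir vs f =1 iter_dir vs g}.
Proof.
move=> oU fg; elim: vs => //= v vs IH x xU; apply: near_eq_derive.
have : \near x, U x by apply: open_nbhs_nbhs; split=> //; rewrite -inE.
by apply: filterS => y Uy; apply: IH; rewrite inE.
Qed.

Lemma iter_dir_sum U n (c : 'I_n -> R) (h : 'I_n -> V -> V) vs : open U ->
  (forall j, smooth_on U (h j)) ->
  {in U, iter_dir vs (fun x => \sum_j c j *: h j x) =1
         (fun x => \sum_j c j *: iter_dir vs (h j) x)}.
Proof.
move=> oU sh; elim: vs => //= v vs IH x xU.
have Ux : U x by rewrite -inE.
transitivity ('D_v (fun y => \sum_j c j *: iter_dir vs (h j) y) x).
  apply: near_eq_derive.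
  have : \near x, U x by apply: open_nbhs_nbhs; split.
  by apply: filterS => y Uy; apply: IH; rewrite inE.
have dh j : derivable (iter_dir vs (h j)) x v by have [_] := sh j vs x Ux; apply.
rewrite (_ : (fun y => _) = \sum_j (c j \*: iter_dir vs (h j))); last first.
  by apply/funext => y; rewrite fct_sumE.
rewrite derive_sum => [|j]; last exact: derivableZ.
by apply: eq_bigr => j _; rewrite deriveZ.
Qed.

Lemma derive_sum_coord f x (u : V) : differentiable f x ->
  'D_u f x = \sum_j u 0 j *: 'D_(delta_mx 0 j) f x.
Proof.
move=> df; rewrite deriveE // {1}(row_sum_delta u) linear_sum.
by apply: eq_bigr => j _; rewrite linearZ deriveE.
Qed.

(** The innermost derivative is peeled off and expanded in the basis. Its coefficients are linear in
    u and constant in the point, so they pass through the remaining derivatives and induction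
    applies to each partial derivative of f. The matrix K leaves room for the normalisation at 0. *)
Lemma iter_dir_hpolyf U f x (K : 'M[R]_4) k i : open U -> smooth_on U f -> U x ->
  hpolyf k (fun u => iter_dir (nseq k (u *m K)) f x 0 i).
Proof.
move=> oU sf Ux; elim: k f sf => [|k IH] f sf; first exact: hpolyf_cst.
pose d j : V := delta_mx 0 j.
apply: (@hpolyf_ext _ _ _ (fun u => \sum_j (\sum_l u 0 l * K l j) *
    iter_dir (nseq k (u *m K)) ('D_(d j) f) x 0 i)) => [u|].
  have -> : nseq k.+1 (u *m K) = rcons (nseq k (u *m K)) (u *m K).
    by elim: (k) => //= m ->.
  have xU : x \in U by rewrite inE.
  have DE : {in U, 'D_(u *m K) f =1 fun y => \sum_j (u *m K) 0 j *: 'D_(d j) f y}.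
    move=> y; rewrite inE => Uy; apply: derive_sum_coord.
    exact: smooth_on_differentiable Uy.
  have E1 := iter_dir_eq_on (nseq k (u *m K)) oU DE xU.
  have E2 := iter_dir_sum (fun j => (u *m K) 0 j) (nseq k (u *m K)) oU
    (fun j => smooth_on_derive (d j) sf) xU.
  rewrite iter_dir_rcons.
  apply: etrans (congr1 (fun y : V => y 0 i) (etrans E1 E2)) _.
  rewrite summxE; apply: eq_bigr => j _.
  by move: (iter_dir _ _ x) => z; rewrite !mxE.
apply: hpolyf_sum => j; rewrite -add1n; apply: hpolyf_mul.
  apply: hpolyf_sum => l; rewrite -[1%N]/(1 + 0)%N.
  by apply: hpolyf_mul; [exact: hpolyf_coord|exact: hpolyf_cst].
by apply: IH; exact: smooth_on_derive.
Qed.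

End IteratedDerivatives.

(** * Circles through the origin *)

Section Circles.
Variable R : realType.
Local Notation V := (R4 R).

(* The circle through 0 with tangent vector w and curvature vector k at 0;
   a line when k = 0. *)
Definition circle0 (w k : V) : set V :=
  [set x | dot w w *: x = dot x w *: w + (dot w w * dot x x) *: k].

Lemma cos_sin_surj (a b : R) : a ^+ 2 + b ^+ 2 = 1 -> exists t, cos t = a /\ sin t = b.
Proof.
move=> ab; have a1 : -1 <= a <= 1.
  by rewrite -ler_norml -(@ler_pXn2r _ 2) ?nnegrE // expr1n real_normK ?num_real //
    -ab lerDl sqr_ge0.
have sb : sin (acos a) ^+ 2 = b ^+ 2.
  by have := cos2Dsin2 (acos a); rewrite acosK ?in_itv // -ab => /addrI.
move/eqP: sb; rewrite eqf_sqr => /orP[] /eqP sb.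
  by exists (acos a); rewrite acosK ?in_itv.
by exists (- acos a); rewrite cosN sinN acosK ?in_itv // sb opprK.
Qed.

(** On a circle through 0 with centre c one has |x|^2 = 2 <x, c>; decomposing x along the orthogonal
    vectors w and c, both of length r, gives the factor 1 / (2 r^2). Thus k is half the usual
    curvature vector c / r^2. *)
Lemma circle_set_circle0 (c u v : V) (r t0 : R) : 0 < r -> orthonormal2 u v ->
  circ_pt c u v r t0 = 0 ->
  let w := (- (r * sin t0)) *: u + (r * cos t0) *: v in
  let k := (2 * r ^+ 2)^-1 *: c in
  [/\ dot w w = r ^+ 2, dot w k = 0 & circle_set c u v r = circle0 w k].
Proof.
move=> r0 [uu [vv uv]] ct0 w k.
have wE : w = (- (r * sin t0)) *: u + (r * cos t0) *: v by [].
have kE : k = (2 * r ^+ 2)^-1 *: c by [].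
clearbody w k.
have rn0 : r != 0 by rewrite gt_eqF.
set c0 := cos t0 in ct0 wE *; set s0 := sin t0 in ct0 wE *.
have N1 : c0 ^+ 2 + s0 ^+ 2 = 1 := cos2Dsin2 t0.
have cE : c = (- (r * c0)) *: u + (- (r * s0)) *: v.
  move/eqP: ct0; rewrite /circ_pt -addrA addr_eq0 => /eqP ->.
  by rewrite opprD !scaleNr.
have dE a b a' b' : dot (a *: u + b *: v) (a' *: u + b' *: v) = a * a' + b * b'.
  by rewrite !dotDl !dotDr !dotZl !dotZr uu vv uv (dotC v) uv; ring.
have ww : dot w w = r ^+ 2.
  by rewrite wE dE; rewrite -[RHS]mulr1 -N1; ring.
have wc : dot w c = 0 by rewrite wE cE dE; ring.
have cc : dot c c = r ^+ 2.
  by rewrite cE dE -[RHS]mulr1 -N1; ring.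
split=> //; first by rewrite kE dotZr wc mulr0.
apply/seteqP; split=> x; rewrite /circle_set /circle0 /=.
  move=> [t _ <-]; set X := cos t; set Y := sin t.
  have N2 : X ^+ 2 + Y ^+ 2 = 1 := cos2Dsin2 t.
  have -> : circ_pt c u v r t = (r * (X - c0)) *: u + (r * (Y - s0)) *: v.
    rewrite /circ_pt -/X -/Y cE; apply/rowP => i; rewrite !mxE; ring.
  rewrite ww kE [in dot _ w]wE !dE.
  (* P is the tangential component of the chord and Q its squared length, both in units of r. The
     formulas [E1] and [E2] write the chord in the frame formed by w and c. *)
  set P := - (X - c0) * s0 + (Y - s0) * c0.
  set Q := (X - c0) ^+ 2 + (Y - s0) ^+ 2.
  have E1 : X - c0 = - P * s0 - 2^-1 * Q * c0.
    have -> : - P * s0 - 2^-1 * Q * c0 = X * (c0 ^+ 2 + s0 ^+ 2) -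
       2^-1 * c0 * (X ^+ 2 + Y ^+ 2 + (c0 ^+ 2 + s0 ^+ 2)).
      by rewrite /P /Q; field.
    by rewrite N1 N2; field.
  have E2 : Y - s0 = P * c0 - 2^-1 * Q * s0.
    have -> : P * c0 - 2^-1 * Q * s0 = Y * (c0 ^+ 2 + s0 ^+ 2) -
       2^-1 * s0 * (X ^+ 2 + Y ^+ 2 + (c0 ^+ 2 + s0 ^+ 2)).
      by rewrite /P /Q; field.
    by rewrite N1 N2; field.
  have -> : r * (X - c0) * - (r * s0) + r * (Y - s0) * (r * c0) = r ^+ 2 * P.
    by rewrite /P; ring.
  have -> : r * (X - c0) * (r * (X - c0)) + r * (Y - s0) * (r * (Y - s0)) = r ^+ 2 * Q.
    by rewrite /Q; ring.
  rewrite E1 E2 cE wE; apply/rowP => i; rewrite !mxE.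
  by move: P Q (u 0 i) (v 0 i) {E1 E2} => P Q a b; field.
rewrite ww kE => xE; pose p := dot x w / r ^+ 2; pose q := dot x x / (2 * r ^+ 2).
have x_pq : x = p *: w + q *: c.
  have r2 : r ^+ 2 != 0 by rewrite expf_neq0.
  apply: (scalerI r2); rewrite xE scalerDr !scalerA; congr (_ *: _ + _ *: _).
    by rewrite /p; field.
  by rewrite /q; field.
have xx : dot x x = r ^+ 2 * (p ^+ 2 + q ^+ 2).
  rewrite x_pq !dotDl !dotDr !dotZl !dotZr ww cc wc (dotC c) wc; ring.
(* Equivalently p^2 + (q - 1)^2 = 1: the pair (p, q - 1), rotated by the angle t0, is the cosine and
   sine of the required parameter. *)
have pq : p ^+ 2 + q ^+ 2 = 2 * q.
  apply: (@mulfI _ (r ^+ 2)); first by rewrite expf_neq0.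
  by rewrite -xx /q; field.
have [t [tA tB]] : exists t, cos t = - p * s0 - (q - 1) * c0 /\
    sin t = p * c0 - (q - 1) * s0.
  apply: cos_sin_surj.
  have -> : (- p * s0 - (q - 1) * c0) ^+ 2 + (p * c0 - (q - 1) * s0) ^+ 2 =
    (p ^+ 2 + q ^+ 2 - 2 * q + 1) * (c0 ^+ 2 + s0 ^+ 2) by ring.
  by rewrite N1 pq; ring.
exists t => //; rewrite /circ_pt tA tB [RHS]x_pq cE wE.
apply/rowP => i; rewrite !mxE; ring.
Qed.

Lemma tangent_dir0_circle0 (C : set V) (w : V) : tangent_dir0 C w ->
  exists k, [/\ w != 0, dot w k = 0 & C = circle0 w k].
Proof.
case=> [[c [u [v [r [t0 [r0 [uv [-> [ct0 ->]]]]]]]]]|[p [d [t0 [d0 [-> [pd ->]]]]]]].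
  have [ww wk CE] := circle_set_circle0 r0 uv ct0.
  by eexists; split; [|exact: wk|exact: CE]; rewrite -dot_eq0 ww expf_neq0 // gt_eqF.
exists 0; split=> //; first by rewrite dotE !mxE; ring.
have s0 : dot d d != 0 by rewrite dot_eq0.
have -> : p = - t0 *: d by apply/eqP; rewrite scaleNr -addr_eq0 pd.
apply/seteqP; split=> x; rewrite /line_set /circle0 /=.
  by move=> [t _ <-]; rewrite scaler0 addr0 -scalerDl dotZl scalerA mulrC.
rewrite scaler0 addr0 => xE; exists (dot x d / dot d d + t0) => //.
rewrite -scalerDl addrC addrK; apply: (scalerI s0); rewrite xE scalerA.
by congr (_ *: _); field.
Qed.

(** For nonzero w and t and w orthogonal to k, the inversion x / |x|^2 sends this point to k + w /
    (t |w|^2), so the circle is seen as the inverse of a line. The parameter is the one for which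
    the point equals T(t w), see [fracT_circle0]. *)
Definition circle0_pt (w k : V) (t : R) : V :=
  (t / (1 + t ^+ 2 * (dot w w * dot k k))) *: (w + (t * dot w w) *: k).

Lemma circle0_den (w k : V) t : 0 < 1 + t ^+ 2 * (dot w w * dot k k).
Proof.
by rewrite ltr_pwDl // mulr_ge0 ?sqr_ge0 // mulr_ge0 // dot_ge0.
Qed.

Section Parametrization.
Variables (w k : V).
Hypotheses (w0 : w != 0) (wk : dot w k = 0).

Let s0 : dot w w != 0. Proof. by rewrite dot_eq0. Qed.
Let D t : 1 + t ^+ 2 * (dot w w * dot k k) != 0.
Proof. by rewrite gt_eqF ?circle0_den. Qed.

Lemma circle0_pt_dotw t : dot (circle0_pt w k t) w =
  t * dot w w / (1 + t ^+ 2 * (dot w w * dot k k)).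
Proof. by rewrite /circle0_pt dotZl dotDl dotZl (dotC k) wk; field; exact: D. Qed.

Lemma circle0_pt_norm t : dot (circle0_pt w k t) (circle0_pt w k t) =
  t ^+ 2 * dot w w / (1 + t ^+ 2 * (dot w w * dot k k)).
Proof.
rewrite /circle0_pt !dotZl !dotZr !dotDl !dotDr !dotZl !dotZr (dotC k) wk.
by field; exact: D.
Qed.

Lemma circle0_ptP t : circle0 w k (circle0_pt w k t).
Proof.
rewrite /circle0 /= circle0_pt_dotw circle0_pt_norm /circle0_pt.
apply/rowP => i; rewrite !mxE; field; exact: D.
Qed.

Lemma circle0_pt_inj : injective (circle0_pt w k).
Proof.
(* The parameter is recovered from the point as |x|^2 / <x, w>, except at t = 0, the only parameter
   where <x, w> vanishes. The same quotient is the witness in [circle0_surj]. *)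
have tE t : dot (circle0_pt w k t) (circle0_pt w k t) = t * dot (circle0_pt w k t) w.
  by rewrite circle0_pt_dotw circle0_pt_norm; field; exact: D.
have wn0 t : t != 0 -> dot (circle0_pt w k t) w != 0.
  move=> t0; rewrite circle0_pt_dotw mulf_neq0 ?invr_neq0 ?D //.
  by rewrite mulf_neq0.
have nn0 t : (t == 0) = (dot (circle0_pt w k t) w == 0).
  have [->|t0] := eqVneq t 0; first by rewrite circle0_pt_dotw !mul0r eqxx.
  by rewrite (negbTE (wn0 _ t0)).
move=> t u tu; have [t0|t0] := eqVneq t 0.
  by have := nn0 u; rewrite -tu -nn0 t0 eqxx => /eqP.
by apply: (mulIf (wn0 _ t0)); rewrite -tE tu -tE.
Qed.

(** The bound |x|^2 |k|^2 < 1 excludes the point antipodal to 0, which corresponds to t at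
    infinity. *)
Lemma circle0_surj x : circle0 w k x -> dot x x * dot k k < 1 ->
  exists t, x = circle0_pt w k t.
Proof.
move=> xE xk.
have E1 : dot x k = dot x x * dot k k.
  apply: (mulfI s0); have := congr1 (fun y : V => dot y k) xE.
  by rewrite /= dotDl !dotZl wk mulr0 add0r mulrA.
have E2 : dot w w * dot x x * (1 - dot x x * dot k k) = dot x w ^+ 2.
  have := congr1 (fun y : V => dot y x) xE; rewrite /= dotDl !dotZl (dotC w x) (dotC k x) E1.
  by move=> E; rewrite mulrBr mulr1 {1}E; ring.
have [xw|xw] := eqVneq (dot x w) 0.
  exists 0; rewrite /circle0_pt mul0r scale0r; apply/eqP; rewrite -dot_eq0.
  move/eqP: E2; rewrite xw expr0n !mulf_eq0 (negbTE s0) /= => /orP[//|].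
  by rewrite gt_eqF // subr_gt0.
exists (dot x x / dot x w); rewrite /circle0_pt.
have x0 : dot x x != 0.
  apply: contraNneq xw; move=> /eqP; rewrite dot_eq0 => /eqP ->.
  by rewrite dotE !mxE; apply/eqP; ring.
have DE : 1 + (dot x x / dot x w) ^+ 2 * (dot w w * dot k k) =
    dot w w * dot x x / dot x w ^+ 2.
  have -> : 1 + (dot x x / dot x w) ^+ 2 * (dot w w * dot k k) =
    (dot x w ^+ 2 + dot w w * dot x x * (dot x x * dot k k)) / dot x w ^+ 2 by field.
  by rewrite -E2; congr (_ / _); ring.
rewrite DE; apply: (scalerI s0); rewrite xE.
by apply/rowP => i; rewrite !mxE; field; rewrite s0 x0 xw.
Qed.

Lemma circle0_pt_continuous : continuous (circle0_pt w k).
Proof.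
move=> t; apply: continuous_rV4 => i.
rewrite (_ : (fun y => _) = fun y => y / (1 + y ^+ 2 * (dot w w * dot k k)) *
  (w 0 i + y * dot w w * k 0 i)); last by apply/funext => y; rewrite !mxE.
have cid : {for t, continuous (fun y : R => y)} by exact: cvg_id.
have ccst (a : R) : {for t, continuous (fun y : R => a)} by exact: cvg_cst.
apply: continuousM.
  apply: continuousM => //; apply: continuousV; first exact: D.
  apply: continuousD => //; apply: continuousM => //; exact: exprn_continuous.
by apply: continuousD => //; apply: continuousM => //; apply: continuousM.
Qed.

End Parametrization.
End Circles.

(** * Second jet of the rectification *)

Section CurvesOnCircles.
Variable R : realType.
Local Notation V := (R4 R).

Lemma is_derive_dot (a b : R -> V) (a' b' : V) (t : R) :
  is_derive t 1 a a' -> is_derive t 1 b b' ->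
  is_derive t 1 (fun u => dot (a u) (b u)) (dot a' (b t) + dot (a t) b').
Proof.
move=> da db.
rewrite (_ : (fun u => _) = \sum_i ((fun u => a u 0 i) * (fun u => b u 0 i))); last first.
  by apply/funext => u; rewrite fct_sumE.
apply: is_derive_eq; last first.
  rewrite /dot -big_split /=; apply: eq_bigr => i _.
  rewrite addrC; congr (_ + _); exact: erefl.
apply: is_derive_sum => i.
apply: is_derive_eq; first by apply: is_deriveM; exact: is_derive_coord.
by rewrite /GRing.scale /= [b t 0 i * _]mulrC addrC.
Qed.

Lemma near_zero_derive (E E' : R -> R) : (\forall t \near 0, E t = 0) ->
  (\forall t \near (0 : R), is_derive (t : R) 1 E (E' t)) -> \forall t \near 0, E' t = 0.
Proof.
move=> /near_join; apply: filterS2 => t E0 [_ <-].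
rewrite (@near_eq_derive _ _ _ _ (cst 0)) ?derive_cst //.
Qed.

Lemma continuous_inj_covers (l : R -> R) (e : R) : 0 < e ->
  {within `[- e, e], continuous l} -> {in `[- e, e] &, injective l} -> l 0 = 0 ->
  \forall y \near 0, exists2 t, t \in `[- e, e] & l t = y.
Proof.
move=> e0 cl il l0.
have Ie : e \in `[- e, e] by rewrite in_itv /= lexx andbT ge0_cp // ltW.
have Ine : - e \in `[- e, e] by rewrite in_itv /= lexx ge0_cp // ltW.
have I0 : 0 \in `[- e, e] by rewrite in_itv /= oppr_le0 ltW // ltW.
have ne : - e <= e by rewrite ge0_cp // ltW.
have [ab|ab] : (l (- e) < 0 /\ 0 < l e) \/ (l e < 0 /\ 0 < l (- e)).
  have e0' : - e < 0 by rewrite oppr_lt0.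
  have [m|m] := itv_continuous_inj_mono cl il; [left|right].
  - by split; [have := m _ _ Ine I0 e0'|have := m _ _ I0 Ie e0]; rewrite l0.
  - by split; [have := m _ _ Ie I0 e0|have := m _ _ I0 Ine e0']; rewrite l0.
- near=> y; apply: IVT => //.
  have ya : l (- e) < y by near: y; apply: (@cvgr_gt _ _ _ _ id 0 cvg_id); case: ab.
  have yb : y < l e by near: y; apply: (@cvgr_lt _ _ _ _ id 0 cvg_id); case: ab.
  by rewrite ge_min le_max (ltW ya) (ltW yb) orbT.
- near=> y; apply: IVT => //.
  have ya : l e < y by near: y; apply: (@cvgr_gt _ _ _ _ id 0 cvg_id); case: ab.
  have yb : y < l (- e) by near: y; apply: (@cvgr_lt _ _ _ _ id 0 cvg_id); case: ab.
  by rewrite ge_min le_max (ltW ya) (ltW yb) orbT.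
Unshelve. all: by end_near. Qed.

(** Rectification says that f sends the circle germ into a line, whereas the jets need g to send a
    whole line germ into the circle. The coordinate of f along the line is continuous and injective
    in the circle parameter, hence covers a neighbourhood of 0. *)
Lemma rectified_curve (f g : V -> V) (U W : set V) (w k : V) :
  local_diffeo0 f g U W -> w != 0 -> dot w k = 0 ->
  maps_germ_into_line f (circle0 w k) ->
  exists2 d : V, d != 0 & \forall t \near (0 : R), circle0 w k (g (t *: d)).
Proof.
move=> [oU [oW [U0 [f0 [fK [gK [sf sg]]]]]]] w0 wk [L [[p [d [d0 ->]]] fL]].
pose c := circle0_pt w k.
have cc : continuous c by exact: circle0_pt_continuous.
have c0 : c 0 = 0 by rewrite /c /circle0_pt mul0r scale0r.
exists d => //.
have [t0 pE] : exists t0, p = t0 *: d.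
  have [t _] : line_set p d (f 0).
    by have := nbhs_singleton fL; apply; rewrite -c0; exact: circle0_ptP.
  by rewrite f0 => /eqP; rewrite addr_eq0 => /eqP ->; exists (- t); rewrite scaleNr.
have s0 : dot d d != 0 by rewrite dot_eq0.
pose l t := dot (f (c t)) d / dot d d.
have : \forall x \near (0 : V), U x /\ (circle0 w k x -> line_set p d (f x)).
  near=> x; split; last by near: x.
  by near: x; apply: open_nbhs_nbhs.
rewrite -{1}c0 => /cc /nbhs_ballP[e /= epos ce].
have e20 : 0 < e / 2 by rewrite divr_gt0.
have inI t : t \in `[- (e / 2), e / 2] -> U (c t) /\ f (c t) = l t *: d.
  rewrite in_itv /= -ler_norml => te.
  have [] : U (c t) /\ (circle0 w k (c t) -> line_set p d (f (c t))).
    apply: ce; rewrite -ball_normE /= sub0r normrN (le_lt_trans te) //.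
    by rewrite ltr_pdivrMr // ltr_pMr // ltr1n.
  move=> Uc /(_ (circle0_ptP wk t)) [u _ fE]; split=> //.
  by rewrite /l -fE pE -scalerDl dotZl mulfK.
have cl : {within `[- (e / 2), e / 2], continuous l}.
  apply: continuous_in_subspaceT => t; rewrite inE => tI.
  have [Uc _] := inI t tI.
  have cf : {for t, continuous (f \o c)}.
    by apply: continuous_comp; [exact: cc|have [] := sf [::] (c t) Uc].
  have ci i : {for t, continuous (fun y : R => f (c y) 0 i * d 0 i)}.
    apply: continuousM; last exact: cst_continuous.
    apply: (@continuous_comp _ _ _ (f \o c) (fun x : V => x 0 i) t) => //.
    exact: coord_continuous.
  pose l' (y : R) := (f (c y) 0 e0 * d 0 e0 +
      f (c y) 0 e1 * d 0 e1 + f (c y) 0 e2 * d 0 e2 + f (c y) 0 e3 * d 0 e3) / dot d d.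
  have cl' : {for t, continuous l'}.
    apply: continuousM; last exact: cst_continuous.
    by do 3?apply: continuousD.
  by have -> : l = l' by apply/funext => y; rewrite /l dotE.
have il : {in `[- (e / 2), e / 2] &, injective l}.
  move=> t u tI uI ltu; apply: (circle0_pt_inj w0 wk).
  have [Ut ft] := inI t tI; have [Uu fu] := inI u uI.
  have [_ Et] := fK _ Ut; have [_ Eu] := fK _ Uu.
  by rewrite -/(c t) -/(c u) -Et -Eu ft fu ltu.
have l0 : l 0 = 0 by rewrite /l c0 f0 dotE !mxE; ring.
have := continuous_inj_covers e20 cl il l0.
apply: filterS => y [t tI ty].
have [Ut ft] := inI t tI; rewrite -ty -ft; have [_ ->] := fK _ Ut.
exact: circle0_ptP wk t.
Unshelve. all: by end_near. Qed.

End CurvesOnCircles.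

Section Jets.
Variable R : realType.
Local Notation V := (R4 R).

Lemma is_derive_lincomb (F G : R -> R) (a b F' G' t : R) :
  is_derive t 1 F F' -> is_derive t 1 G G' ->
  is_derive t 1 (fun u => a * F u + b * G u) (a * F' + b * G').
Proof.
move=> dF dG.
exact: (@is_deriveD _ _ _ (a \*: F) (b \*: G) t 1 (a *: F') (b *: G')).
Qed.

Lemma circle_tangent (phi : R -> V) (v k phi' : V) : phi 0 = 0 ->
  is_derive (0 : R) 1 phi phi' -> (\forall t \near (0 : R), circle0 v k (phi t)) ->
  dot v v *: phi' = dot phi' v *: v.
Proof.
move=> phi0 dphi phiC; apply/rowP => i.
pose E (t : R) := 1 * (dot v v * phi t 0 i + - v 0 i * dot (phi t) v)
  + - (dot v v * k 0 i) * dot (phi t) (phi t).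
have E0 : \forall t \near (0 : R), E t = 0.
  apply: filterS phiC => t /(congr1 (fun x : V => x 0 i)).
  by rewrite /E; move: (phi t) => x; rewrite !mxE => ->; ring.
have dot0r x : dot x 0 = 0 :> R by rewrite dotE !mxE; ring.
have [_] : is_derive (0 : R) 1 E (1 * (dot v v * phi' 0 i + - v 0 i * dot phi' v) + 0).
  rewrite -[X in _ + X](mulr0 (- (dot v v * k 0 i))).
  apply: is_derive_lincomb; last first.
    apply: is_derive_eq; first exact: is_derive_dot.
    by rewrite phi0 (dotC 0) !dot0r addr0.
  apply: is_derive_lincomb; first exact: is_derive_coord.
  apply: is_derive_eq; first by apply: is_derive_dot; exact: is_derive_cst.
  by rewrite dot0r addr0.
rewrite (@near_eq_derive _ _ _ _ (cst 0)) // derive_cst => h.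
by rewrite !mxE; apply/eqP; rewrite -subr_eq0 h; apply/eqP; ring.
Qed.

(** The circle equation is differentiated up to four times along phi(t) = g(t u) and evaluated at 0.
    The constants are Leibniz coefficients of |phi|^2 with phi(0) = 0: its derivatives of orders 2,
    3, 4 are 2 |phi'|^2, 6 <phi', phi''> and 6 |phi''|^2 + 8 <phi', phi'''>. *)
Lemma circle_jet (g : V -> V) (W : set V) (u v k : V) : open W -> W 0 -> g 0 = 0 ->
  smooth_on W g -> 'D_u g 0 = v ->
  (\forall t \near (0 : R), circle0 v k (g (t *: u))) ->
  let P n := iter_dir (nseq n u) g 0 in let s := dot v v in
  [/\ s *: P 2 = dot (P 2) v *: v + (2 * (s * s)) *: k,
      s *: P 3 = dot (P 3) v *: v + (6 * dot v (P 2) * s) *: k &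
      s *: P 4 = dot (P 4) v *: v
        + ((6 * dot (P 2) (P 2) + 8 * dot v (P 3)) * s) *: k].
Proof.
move=> oW W0 g0 sg gv gC P s.
pose phi n (t : R) := iter_dir (nseq n u) g (t *: u).
have phiD n : \forall t \near (0 : R), is_derive (t : R) 1 (phi n) (phi n.+1 t).
  have : \forall t \near (0 : R), W (t *: u).
    have c : {for 0, continuous (fun t : R => t *: u)} by exact: scalel_continuous.
    by apply: c; rewrite scale0r; exact: open_nbhs_nbhs.
  apply: filterS => t Wt.
  have [_ /(_ u) d] := sg (nseq n u) _ Wt.
  have := @is_derive_line R (iter_dir (nseq n u) g) 0 u t.
  rewrite add0r => /(_ d).
  by under eq_fun do rewrite add0r.
have phi0 n : phi n 0 = P n by rewrite /phi scale0r.
pose dd i j t := dot (phi i t) (phi j t).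
have ddD i j : \forall t \near (0 : R), is_derive (t : R) 1 (dd i j)
    (dd i.+1 j t + dd i j.+1 t).
  by apply: filterS2 (phiD i) (phiD j) => t; exact: is_derive_dot.
have phi00 t : phi 0%N t = g (t *: u) by [].
have ddE i j t : dd i j t = dot (phi i t) (phi j t) by [].
have ddC i j t : dd i j t = dd j i t by rewrite /dd dotC.
have P0 : P 0%N = 0 by exact: g0.
have P1 : P 1%N = v by exact: gv.
clearbody dd phi P.
pose E n (psi : R -> R) i (t : R) :=
  1 * (s * phi n t 0 i + - v 0 i * dot (phi n t) v) + - (s * k 0 i) * psi t.
have step n (psi psi' : R -> R) : (\forall t \near (0 : R), is_derive (t : R) 1 psi (psi' t)) ->
    (forall i, \forall t \near (0 : R), E n psi i t = 0) ->
    forall i, \forall t \near (0 : R), E n.+1 psi' i t = 0.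
  move=> dpsi En i; apply: near_zero_derive (En i) _.
  apply: filterS2 (phiD n) dpsi => t dphi dp.
  apply: is_derive_lincomb => //; apply: is_derive_lincomb; first exact: is_derive_coord.
  apply: is_derive_eq; first by apply: is_derive_dot; exact: is_derive_cst.
  by rewrite [dot (phi n t) 0]dotE !mxE !mulr0 !addr0.
have En0 i : \forall t \near (0 : R), E 0%N (dd 0%N 0%N) i t = 0.
  apply: filterS gC => t /(congr1 (fun x : V => x 0 i)).
  rewrite -phi00 /E ddE; move: (phi 0%N t) => x; rewrite !mxE -/s => ->; ring.
(* The zero term gives the right-hand side the two-term shape that [is_derive_lincomb]
   differentiates. *)
have En1 := step _ _ (fun t => 2 * dd 0%N 1%N t + 0 * dd 0%N 0%N t) _ En0.
have {}En1 i : \forall t \near (0 : R),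
    E 1%N (fun t => 2 * dd 0%N 1%N t + 0 * dd 0%N 0%N t) i t = 0.
  apply: En1; apply: filterS (ddD 0%N 0%N) => t d; apply: is_derive_eq.
  by rewrite (ddC 1%N 0%N); ring.
have En2 i : \forall t \near (0 : R), E 2%N (fun t => 2 * dd 1%N 1%N t + 2 * dd 0%N 2%N t) i t = 0.
  move: i; apply: step En1.
  apply: filterS2 (ddD 0%N 1%N) (ddD 0%N 0%N) => t d1 d2.
  apply: (is_derive_eq (is_derive_lincomb 2 0 d1 d2)).
  ring.
have En3 i : \forall t \near (0 : R), E 3%N (fun t => 6 * dd 1%N 2%N t + 2 * dd 0%N 3%N t) i t = 0.
  move: i; apply: step En2.
  apply: filterS2 (ddD 1%N 1%N) (ddD 0%N 2%N) => t d1 d2.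
  apply: (is_derive_eq (is_derive_lincomb 2 2 d1 d2)).
  rewrite (ddC 2%N 1%N); ring.
have En4 i : \forall t \near (0 : R),
    E 4%N (fun t => 6 * dd 2%N 2%N t + 8 * dd 1%N 3%N t + 2 * dd 0%N 4%N t) i t = 0.
  move: i; apply: step En3.
  apply: filterS2 (ddD 1%N 2%N) (ddD 0%N 3%N) => t d1 d2.
  apply: (is_derive_eq (is_derive_lincomb 6 2 d1 d2)).
  ring.
have d0 x : dot 0 x = 0 by rewrite dotE !mxE; ring.
split; apply/rowP => i.
- have := nbhs_singleton (En2 i).
  rewrite /E !ddE !phi0 P0 P1 d0 -/s !mxE.
  by move: (P 2%N) => p h; apply/eqP; rewrite -subr_eq0 -h; apply/eqP; ring.
- have := nbhs_singleton (En3 i).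
  rewrite /E !ddE !phi0 P0 P1 d0 !mxE.
  by move: (P 2%N) (P 3%N) => p q h; apply/eqP; rewrite -subr_eq0 -h; apply/eqP; ring.
- have := nbhs_singleton (En4 i).
  rewrite /E !ddE !phi0 P0 P1 d0 !mxE.
  by move: (P 2%N) (P 3%N) (P 4%N) => p q r h; apply/eqP; rewrite -subr_eq0 -h; apply/eqP; ring.
Qed.

End Jets.

Section SecondJet.
Variable R : realType.
Local Notation V := (R4 R).

Lemma local_diffeo0_jacobian (f g : V -> V) (U W : set V) : local_diffeo0 f g U W ->
  [/\ W 0, g 0 = 0, forall x, 'd g 0 ('d f 0 x) = x & forall x, 'd f 0 ('d g 0 x) = x].
Proof.
move=> [oU [oW [U0 [f0 [fK [gK [sf sg]]]]]]].
have [W0 g0] : W 0 /\ g 0 = 0 by have := fK 0 U0; rewrite f0.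
have df : differentiable f 0 := smooth_on_differentiable oU sf U0.
have dg : differentiable g 0 := smooth_on_differentiable oW sg W0.
have dfg := @diff_comp _ _ _ _ f g 0 df; rewrite f0 in dfg.
have dgf := @diff_comp _ _ _ _ g f 0 dg; rewrite g0 in dgf.
have cfg := @differentiable_comp _ _ _ _ f g 0 df; rewrite f0 in cfg.
have cgf := @differentiable_comp _ _ _ _ g f 0 dg; rewrite g0 in cgf.
have idE (h : V -> V) : differentiable h 0 -> (\forall x \near (0 : V), h x = x) ->
    forall x, 'd h 0 x = x.
  move=> dh hx x; rewrite -deriveE //.
  by rewrite (@near_eq_derive _ _ _ _ id) // derive_id.
split=> // x.
- apply: etrans (esym (congr1 (fun h : V -> V => h x) (dfg dg))) _.
  apply: idE; first exact: cfg.
  by apply: (@filterS _ _ _ U) => [y /fK[]//|]; exact: open_nbhs_nbhs.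
- apply: etrans (esym (congr1 (fun h : V -> V => h x) (dgf df))) _.
  apply: idE; first exact: cgf.
  by apply: (@filterS _ _ _ W) => [y /gK[]//|]; exact: open_nbhs_nbhs.
Qed.

Lemma rectifiable_second_jet (S : set (set V)) :
  tangent_zariski_dense S -> rectifiable S ->
  exists (w : V -> V) (M : 'M[R]_4), [/\ forall v, dot v (w v) = 0,
    forall C v, S C -> tangent_dir0 C v ->
      exists k, [/\ v != 0, dot v k = 0, C = circle0 v k & w v = dot v v *: k] &
    (forall v, w v = qmul (v *m M) v) \/ (forall v, w v = qmul v (v *m M))].
Proof.
move=> dens [f [g [U [W [fg fS]]]]].
have [W0 g0 gf' fg'] := local_diffeo0_jacobian fg.
have [oU [oW [U0 [f0 [fK [gK [sf sg]]]]]]] := fg.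
have df : differentiable f 0 := smooth_on_differentiable oU sf U0.
have [K KE] : exists K : 'M[R]_4, forall v, v *m K = 'd f 0 v.
  exists ('J f 0) => v; have DJ := @deriveEjacobian _ _ _ f 0 v df.
  have DE := @deriveE _ _ _ f 0 v df.
  exact: (etrans (esym DJ) DE).
have dg : differentiable g 0 := smooth_on_differentiable oW sg W0.
pose P n v := iter_dir (nseq n (v *m K)) g 0.
have hP n i : hpolyf n (fun v => P n v 0 i).
  exact: (@iter_dir_hpolyf R W g 0 K n i oW sg W0).
pose D v := exists2 C, S C & tangent_dir0 C v.
have densD d F : hpolyf d F -> (forall v, D v -> F v = 0) -> forall v, F v = 0.
  move=> hF FD; have [p hp pE] := hpolyf_peval hF.
  suff p0 : p = 0 by move=> v; rewrite pE p0 /peval mpoly.meval0.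
  apply: (dens d) => // C w c SC Cw; rewrite -pE (hpolyfZ _ _ hF) FD ?mulr0 //.
  by exists C.
have jet C v : S C -> tangent_dir0 C v -> exists k,
    [/\ v != 0, dot v k = 0, C = circle0 v k &
     let s := dot v v in
     [/\ s *: P 2 v = dot (P 2 v) v *: v + (2 * (s * s)) *: k,
      s *: P 3 v = dot (P 3 v) v *: v + (6 * dot v (P 2 v) * s) *: k &
      s *: P 4 v = dot (P 4 v) v *: v
        + ((6 * dot (P 2 v) (P 2 v) + 8 * dot v (P 3 v)) * s) *: k]].
  move=> SC Cv; have [k [v0 vk CE]] := tangent_dir0_circle0 Cv.
  exists k; split=> //.
  have s0 : dot v v != 0 by rewrite dot_eq0.
  have := fS C SC; rewrite CE => Ck.
  have [d d0 dC] := rectified_curve fg v0 vk Ck.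
  (* The line found has some direction d; its image under g is tangent to the circle, so d is a
     nonzero multiple c of v K. Replacing t by t / c gives a curve with velocity exactly v. *)
  pose c := dot ('d g 0 d) v / dot v v.
  have dc : 'd g 0 d = c *: v.
    have gder : is_derive (0 : R) 1 (fun t : R => g (t *: d)) ('D_d g 0).
      have [_ /(_ d) gd] := sg [::] 0 W0.
      have := @is_derive_line R g 0 d 0; rewrite scale0r addr0 => /(_ gd).
      by under eq_fun do rewrite add0r.
    have g00 : g (0 *: d) = 0 by rewrite scale0r.
    have := circle_tangent g00 gder dC.
    rewrite /c -(@deriveE _ _ _ g 0 d dg); move: ('D_d g 0) => J JE.
    by apply: (scalerI s0); rewrite JE scalerA mulrC divfK.
  have dE : d = c *: (v *m K) by rewrite KE -linearZ -dc fg'.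
  have c0 : c != 0 by apply: contraNneq d0 => c0; rewrite dE c0 scale0r.
  have vC : \forall t \near (0 : R), circle0 v k (g (t *: (v *m K))).
    have cc : {for 0, continuous (fun t : R => t / c)}.
      by apply: continuousM; [exact: cvg_id|exact: cst_continuous].
    have dC' : nbhs ((0 : R) / c) [set t | circle0 v k (g (t *: d))].
      by rewrite mul0r.
    have h : nbhs (0 : R) [set t | circle0 v k (g (t / c *: d))] := cc _ dC'.
    apply: filterS h => t /=; rewrite [in t / c *: _]dE scalerA divfK //.
  have DE := @deriveE _ _ _ g 0 (v *m K) dg.
  have gv : 'D_(v *m K) g 0 = v by apply: etrans DE _; rewrite KE; exact: gf'.
  exact: (circle_jet oW W0 g0 sg gv vC).
clearbody P.
pose G n v := (n`!%:R)^-1 *: P n v.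
have hG n i : hpolyf n (fun v => G n v 0 i).
  apply: (@hpolyf_ext _ _ _ (fun v => (n`!%:R)^-1 * P n v 0 i)) => [v|].
    by rewrite mxE.
  exact: hpolyf_scale.
have GE n v : G n v = n`!%:R^-1 *: P n v by [].
clearbody G.
have scaleC (a b : R) (x : V) : a *: (b *: x) = b *: (a *: x).
  by rewrite !scalerA mulrC.
have jetG v : D v -> exists k, let s := dot v v in
    [/\ s *: G 2 v = dot (G 2 v) v *: v + (s * s) *: k,
        s *: G 3 v = dot (G 3 v) v *: v + (2 * dot v (G 2 v) * s) *: k &
        s *: G 4 v = dot (G 4 v) v *: v
          + ((dot (G 2 v) (G 2 v) + 2 * dot v (G 3 v)) * s) *: k].
  move=> [C SC Cv]; have [k [_ _ _ [j2 j3 j4]]] := jet C v SC Cv.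
  exists k; rewrite !GE -[2`!]/2%N -[3`!]/6%N -[4`!]/24%N.
  move: (P 2 v) (P 3 v) (P 4 v) j2 j3 j4 => p2 p3 p4 j2 j3 j4.
  by split; rewrite !(dotZl, dotZr) [LHS]scaleC ?j2 ?j3 ?j4
    scalerDr !scalerA; congr (_ *: _ + _ *: _); field.
have [w [M [vw wE HM]]] :=
  quaternionic_second_jet densD (hG 2) (hG 3) (hG 4) jetG.
exists w, M; split=> // C v SC Cv.
have [k [v0 vk CE [j2 _ _]]] := jet C v SC Cv; exists k; split=> //.
have s0 : dot v v != 0 by rewrite dot_eq0.
apply: (scalerI s0); have := wE v; rewrite GE -[2`!]/2%N.
move: (P 2 v) j2 => p2 j2; rewrite dotZl [in LHS]scaleC j2.
rewrite scalerDr !scalerA => /addrI <-; congr (_ *: _).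
by field.
Qed.

End SecondJet.

(** * Rational maps and quaternionic fractions *)

Section RationalMaps.
Variable R : realType.
Local Notation V := (R4 R).

Lemma polyf_continuous (F : V -> R) : polyf F -> continuous F.
Proof.
elim=> [c|i|G H _ cG _ cH|G H _ cG _ cH] x.
- exact: cst_continuous.
- exact: coord_continuous.
- by apply: continuousD; [exact: cG|exact: cH].
- by apply: continuousM; [exact: cG|exact: cH].
Qed.

Lemma polyf_derive (F : V -> R) (v : V) : polyf F ->
  exists2 F', polyf F' & forall x, is_derive x v F (F' x).
Proof.
elim=> [c|i|G H hG [G' hG' dG] hH [H' hH' dH]|G H hG [G' hG' dG] hH [H' hH' dH]].
- by exists (fun=> 0) => [|x]; [exact: polyf_cst|exact: is_derive_cst].
- exists (fun=> v 0 i) => [|x]; first exact: polyf_cst.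
  by apply: is_derive_coord; exact: is_derive_id.
- exists (fun x => G' x + H' x) => [|x]; first exact: polyf_add.
  exact: is_deriveD.
- exists (fun x => G x * H' x + H x * G' x) => [|x].
    by apply: polyf_add; exact: polyf_mul.
  exact: is_deriveM.
Qed.

(** A common scalar denominator makes this class stable under directional derivatives by the
    quotient rule, which yields smoothness by induction on the list of directions. *)
Definition ratf (U : set V) (f : V -> V) : Prop :=
  exists q (p : V -> V), [/\ polyf q, forall i, polyf (fun x => p x 0 i),
    forall x, U x -> q x != 0 & forall x, U x -> f x = (q x)^-1 *: p x].

Lemma is_derive_ratio (q p : V -> R) (x v : V) (q' p' : R) : q x != 0 ->
  is_derive x v q q' -> is_derive x v p p' ->
  is_derive x v (fun y => (q y)^-1 * p y) ((q x * q x)^-1 * (q x * p' - q' * p x)).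
Proof.
move=> q0 [dq <-] dp.
have dV : is_derive x v (fun y => (q y)^-1) (- (q x) ^- 2 *: 'D_v q x).
  by apply: DeriveDef; [exact: derivableV|rewrite deriveV].
have := @is_deriveM _ _ _ _ x v _ _ dV dp.
move=> dM; apply: (is_derive_eq dM); move: ('D_v q x) => d.
by rewrite /GRing.scale /=; field.
Qed.

Lemma ratf_continuous (U : set V) f x : open U -> ratf U f -> U x ->
  {for x, continuous f}.
Proof.
move=> oU [q [p [hq hp q0 fE]]] Ux.
have cr : {for x, continuous (fun y => (q y)^-1 *: p y)}.
  apply: continuous_rV4 => i.
  rewrite (_ : (fun y => _) = fun y => (q y)^-1 * p y 0 i); last first.
    by apply/funext => y; rewrite mxE.
  apply: continuousM; last exact: polyf_continuous.
  by apply: continuousV; [exact: q0|exact: polyf_continuous].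
rewrite /prop_for /continuous_at fE //; apply: cvg_trans cr.
have Un : \forall y \near x, U y by exact: open_nbhs_nbhs.
by apply: (@near_eq_cvg _ _ (nbhs x) (nbhs_filter x)); apply: filterS Un => y Uy; rewrite fE.
Qed.

Lemma ratf_derive (U : set V) f v : open U -> ratf U f ->
  (forall x, U x -> derivable f x v) /\ ratf U ('D_v f).
Proof.
move=> oU [q [p [hq hp q0 fE]]].
have [q' hq' dq] := polyf_derive v hq.
have /choice [p' Hp'] : forall i, exists F', polyf F' /\
    forall x, is_derive x v (fun x => p x 0 i) (F' x).
  by move=> i; have [F' h1 h2] := polyf_derive v (hp i); exists F'.
pose r x : V := \row_i (q x * p' i x - q' x * p x 0 i).
have df x : U x -> is_derive x v f ((q x * q x)^-1 *: r x).
  move=> Ux; apply: (@near_eq_is_derive _ _ _ (fun y => (q y)^-1 *: p y)).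
    have Un : \forall y \near x, U y by exact: open_nbhs_nbhs.
    by apply: filterS Un => y Uy; rewrite fE.
  have dc i : is_derive x v (fun y => ((q y)^-1 *: p y) 0 i) (((q x * q x)^-1 *: r x) 0 i).
    rewrite (_ : (fun y => _) = fun y => (q y)^-1 * p y 0 i); last first.
      by apply/funext => y; rewrite mxE.
    by rewrite !mxE; exact: is_derive_ratio (q0 x Ux) (dq x) ((Hp' i).2 x).
  have dd : derivable (fun y => (q y)^-1 *: p y) x v.
    by apply/derivable_mxP => j i; rewrite (ord1 j); case: (dc i).
  apply: DeriveDef => //; rewrite derive_mx //; apply/rowP => i.
  by rewrite [LHS]mxE; case: (dc i).
split; first by move=> x /df[].
exists (fun x => q x * q x), r; split.
- exact: polyf_mul.
- move=> i; apply: (@polyf_ext _ _ (fun x => q x * p' i x + - (q' x * p x 0 i))).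
    by move=> x; rewrite mxE.
  apply: polyf_add; first by apply: polyf_mul => //; exact: (Hp' i).1.
  by apply: polyf_opp; exact: polyf_mul.
- by move=> x Ux; rewrite mulf_neq0 ?q0.
- by move=> x /df[].
Qed.

Lemma ratf_smooth (U : set V) f : open U -> ratf U f -> smooth_on U f.
Proof.
move=> oU rf vs; have {rf} : ratf U (iter_dir vs f).
  by elim: vs => //= v vs /(ratf_derive v oU)[].
move: (iter_dir vs f) => h rh x Ux; split; first exact: ratf_continuous rh Ux.
by move=> v; have [d _] := ratf_derive v oU rh; exact: d.
Qed.

Lemma polyf_det n (A : V -> 'M[R]_n) : (forall i j, polyf (fun x => A x i j)) ->
  polyf (fun x => \det (A x)).
Proof.
move=> hA; apply: polyf_sum => s; apply: polyf_mul; first exact: polyf_cst.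
exact: polyf_prod.
Qed.

Lemma polyf_adj n (A : V -> 'M[R]_n) i j : (forall i j, polyf (fun x => A x i j)) ->
  polyf (fun x => (\adj (A x)) i j).
Proof.
move=> hA; apply: (@polyf_ext _ _ (fun x => (-1) ^+ (j + i) *
    \det (row' j (col' i (A x))))) => [x|]; first by rewrite mxE.
apply: polyf_mul; first exact: polyf_cst.
apply: polyf_det => k l; apply: (@polyf_ext _ _ (fun x => A x (lift j k) (lift i l))) => // x.
by rewrite !mxE.
Qed.

End RationalMaps.

(** * The fractional map T, its rational inverse and its action on lines *)

Section QuaternionicFractions.
Variable R : realType.
Local Notation V := (R4 R).

Definition qone : V := mkq 1 0 0 0.

(* Left or right quaternionic multiplication, so that both forms of T in the
   theorem are treated at once. *)
Variable mul : V -> V -> V.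
Hypothesis mulE : mul = @qmul R \/ mul = (fun x y => qmul y x).

Lemma mul_linear a b x y z : mul (a *: x + b *: y) z = a *: mul x z + b *: mul y z.
Proof. by case: mulE => ->; apply: R4P; rewrite /qmul !mxE /=; ring. Qed.

Lemma mulZl a x z : mul (a *: x) z = a *: mul x z.
Proof. by have := mul_linear a 0 x 0 z; rewrite !scale0r !addr0. Qed.

Lemma mulZ a x z : mul x (a *: z) = a *: mul x z.
Proof. by case: mulE => ->; rewrite ?qmulZl ?qmulZr. Qed.

Lemma mulD x y z : mul x (y + z) = mul x y + mul x z.
Proof. by case: mulE => ->; apply: R4P; rewrite /qmul !mxE /=; ring. Qed.

Lemma mul1 x : mul qone x = x.
Proof. by case: mulE => ->; apply: R4P; rewrite /qmul !mxE /=; ring. Qed.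

Lemma mulx0 x : mul x 0 = 0.
Proof. by rewrite -[0 in LHS](scale0r 0) mulZ scale0r. Qed.

(** The quadratic equation x^2 = 2 Re(x) x - |x|^2 of a quaternion, applied to y. For imaginary x it
    reads x^2 = - |x|^2. *)
Lemma mul_sq x y : mul x (mul x y) = (2 * x 0 e0) *: mul x y - dot x x *: y.
Proof. by case: mulE => ->; apply: R4P; rewrite dotE /qmul !mkqs !mxE /=; ring. Qed.

Lemma mul_qinv x y : x != 0 -> mul x (mul (qinv x) y) = y.
Proof.
rewrite -dot_eq0 /qinv => x0.
have -> : mul ((dot x x)^-1 *: qconj x) y = (dot x x)^-1 *: mul (qconj x) y.
  exact: mulZl.
apply: (scalerI x0); rewrite mulZ scalerA mulfV // scale1r.
by case: mulE => ->; apply: R4P; rewrite dotE /qmul /qconj !mkqs !mxE /=; ring.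
Qed.

Lemma qinv_mul x y : x != 0 -> mul (qinv x) (mul x y) = y.
Proof.
rewrite -dot_eq0 /qinv => x0.
have -> : mul ((dot x x)^-1 *: qconj x) (mul x y) = (dot x x)^-1 *: mul (qconj x) (mul x y).
  exact: mulZl.
apply: (scalerI x0); rewrite scalerA mulfV // scale1r.
by case: mulE => ->; apply: R4P; rewrite dotE /qmul /qconj !mkqs !mxE /=; ring.
Qed.

Lemma dot_mul x y : dot y (mul x y) = x 0 e0 * dot y y.
Proof. by case: mulE => ->; rewrite !dotE /qmul !mkqs; ring. Qed.

Lemma norm_mul x y : dot (mul x y) (mul x y) = dot x x * dot y y.
Proof. by case: mulE => ->; rewrite !dotE /qmul !mkqs; ring. Qed.

Lemma polyf_mulq (X Y : V -> V) : (forall i, polyf (fun x => X x 0 i)) ->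
  (forall i, polyf (fun x => Y x 0 i)) ->
  forall i, polyf (fun x => mul (X x) (Y x) 0 i).
Proof.
move=> hX hY; case: mulE => ->; apply: ord4P; under eq_fun do rewrite /qmul !mkqs;
  do 8?[apply: polyf_add|apply: polyf_opp|apply: polyf_mul] => //;
  do 8?[apply: polyf_add|apply: polyf_opp|apply: polyf_mul] => //.
Qed.

Variable M : 'M[R]_4.

Definition fracB (x : V) : V := qone - x *m M.
Definition fracT (x : V) : V := mul (qinv (fracB x)) x.
(* [x = y - (x M) y], the equation T x = y with its denominator cleared,
   is linear in x and reads [x *m fracN y = y]. *)
Definition fracN (y : V) : 'M[R]_4 :=
  1%:M + M *m \matrix_(j, i) mul (delta_mx 0 j) y 0 i.
(** Cramer's rule for the linear equation above, which makes the inverse visibly rational. *)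
Definition fracTinv (y : V) : V := (\det (fracN y))^-1 *: (y *m \adj (fracN y)).

Lemma mul_delta x y : x *m (\matrix_(j, i) mul (delta_mx 0 j) y 0 i) = mul x y.
Proof.
apply/rowP => i; rewrite mxE sum4 !mxE.
by move: i; case: mulE => ->; apply: ord4P; rewrite /qmul !mkqs !mxE /=; ring.
Qed.

Lemma mul_fracN x y : x *m fracN y = x + mul (x *m M) y.
Proof. by rewrite /fracN mulmxDr mulmx1 mulmxA mul_delta. Qed.

Lemma mul_fracB x y : mul (fracB x) y = y - mul (x *m M) y.
Proof.
have := mul_linear 1 (-1) qone (x *m M) y.
by rewrite !scale1r !scaleN1r mul1.
Qed.

Lemma mul_fracN_eq x y : x *m fracN y = y <-> mul (fracB x) y = x.
Proof.
rewrite mul_fracN mul_fracB; split=> [E|E]; first by rewrite -{1}E addrK.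
by rewrite -{1}E subrK.
Qed.

Lemma fracTinvP x y : \det (fracN y) != 0 -> x = fracTinv y <-> x *m fracN y = y.
Proof.
move=> d0; split=> [->|E].
  rewrite /fracTinv -scalemxAl -mulmxA mul_adj_mx mul_mx_scalar scalerA mulVf //.
  by rewrite scale1r.
rewrite /fracTinv -{2}E -mulmxA mul_mx_adj mul_mx_scalar scalerA mulVf //.
by rewrite scale1r.
Qed.

Lemma qone_neq0 : qone != 0.
Proof.
by apply/eqP => /(congr1 (fun x : V => x 0 e0)); rewrite mkqs mxE => /eqP; rewrite oner_eq0.
Qed.

Lemma fracB0 : fracB 0 = qone. Proof. by rewrite /fracB mul0mx subr0. Qed.

Lemma fracT0 : fracT 0 = 0. Proof. exact: mulx0. Qed.

Lemma fracN0 : fracN 0 = 1%:M.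
Proof.
rewrite /fracN (_ : \matrix_(j, i) _ = 0) ?mulmx0 ?addr0 //.
by apply/matrixP => i j; rewrite !mxE mulx0 mxE.
Qed.

Definition fracW : set V := [set y | \det (fracN y) != 0].
Definition fracU : set V := [set x | fracB x != 0 /\ fracW (fracT x)].

Lemma polyf_mulmx (A : 'M[R]_4) i : polyf (fun x => (x *m A) 0 i).
Proof.
apply: (@polyf_ext _ _ (fun x => \sum_j x 0 j * A j i)) => [x|]; first by rewrite mxE.
by apply: polyf_sum => j; apply: polyf_mul; [exact: polyf_coord|exact: polyf_cst].
Qed.

Lemma polyf_fracB i : polyf (fun x => fracB x 0 i).
Proof.
apply: (@polyf_ext _ _ (fun x => qone 0 i + - (x *m M) 0 i)) => [x|].
  by rewrite !mxE.
by apply: polyf_add; [exact: polyf_cst|apply: polyf_opp; exact: polyf_mulmx].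
Qed.

Lemma polyf_fracN i j : polyf (fun y => fracN y i j).
Proof.
apply: (@polyf_ext _ _ (fun y => (1%:M : 'M[R]_4) i j +
    \sum_k M i k * mul (delta_mx 0 k) y 0 j)) => [y|].
  rewrite mxE [X in _ + X]mxE; congr (_ + _); apply: eq_bigr => k _.
  by rewrite [in LHS]mxE.
apply: polyf_add; first exact: polyf_cst.
apply: polyf_sum => k; apply: polyf_mul; first exact: polyf_cst.
by apply: polyf_mulq => l; [exact: polyf_cst|exact: polyf_coord].
Qed.

Let polyf_detN : polyf (fun y => \det (fracN y)) := polyf_det polyf_fracN.

Lemma open_polyf_neq0 (F : V -> R) : polyf F -> open [set x | F x != 0].
Proof.
move=> /polyf_continuous cF; rewrite (_ : mkset _ = F @^-1` (~` [set 0])).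
  apply: open_comp => [x _|]; first exact: cF.
  by rewrite openC; exact: closed_eq.
by apply/seteqP; split=> x /= /eqP.
Qed.

Lemma open_fracB : open [set x | fracB x != 0].
Proof.
rewrite (_ : mkset _ = [set x | dot (fracB x) (fracB x) != 0]).
  by apply: open_polyf_neq0; apply: polyf_dot => i; exact: polyf_fracB.
by apply/seteqP; split=> x /=; rewrite dot_eq0.
Qed.

Lemma ratf_fracT : ratf [set x | fracB x != 0] fracT.
Proof.
exists (fun x => dot (fracB x) (fracB x)), (fun x => mul (qconj (fracB x)) x); split.
- by apply: polyf_dot => i; exact: polyf_fracB.
- apply: polyf_mulq => i; last exact: polyf_coord.
  move: i; apply: ord4P; under eq_fun do rewrite /qconj !mkqs;
    do ?apply: polyf_opp; exact: polyf_fracB.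
- by move=> x /=; rewrite dot_eq0.
- move=> x _; rewrite /fracT /qinv.
  exact: mulZl.
Qed.

Lemma ratf_fracTinv : ratf fracW fracTinv.
Proof.
exists (fun y => \det (fracN y)), (fun y => y *m \adj (fracN y)); split=> // i.
apply: (@polyf_ext _ _ (fun y => \sum_j y 0 j * (\adj (fracN y)) j i)) => [y|].
  by rewrite mxE.
apply: polyf_sum => j; apply: polyf_mul; first exact: polyf_coord.
by apply: polyf_adj; exact: polyf_fracN.
Qed.

Lemma open_fracW : open fracW.
Proof. exact: open_polyf_neq0. Qed.

Lemma open_fracU : open fracU.
Proof.
rewrite openE => x [Bx Wx]; rewrite /interior.
have cT := ratf_continuous open_fracB ratf_fracT Bx.
have B' : \forall y \near x, fracB y != 0.
  by apply: (@open_nbhs_nbhs _ x [set x | fracB x != 0]); split=> //; exact: open_fracB.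
have W' : \forall y \near x, fracW (fracT y).
  by apply: cT; apply: open_nbhs_nbhs; split=> //; exact: open_fracW.
by apply: filterS2 B' W' => y.
Qed.

Lemma ratfS (A B : set V) f : A `<=` B -> ratf B f -> ratf A f.
Proof.
by move=> AB [q [p [hq hp q0 fE]]]; exists q, p; split=> // x /AB; [exact: q0|exact: fE].
Qed.

Lemma fracT_local_diffeo0 : local_diffeo0 fracT fracTinv fracU fracW.
Proof.
split; first exact: open_fracU.
split; first exact: open_fracW.
split.
  split; first by rewrite fracB0 qone_neq0.
  by rewrite /fracW /= fracT0 fracN0 det1 oner_eq0.
split; first exact: fracT0.
split.
  move=> x [Bx Wx]; split=> //; apply/esym; rewrite fracTinvP //.
  by apply/mul_fracN_eq; exact: mul_qinv.
split.
  move=> y Wy; have /mul_fracN_eq E := (fracTinvP (fracTinv y) Wy).1 erefl.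
  (* If B vanished at x, the equation B(x) y = x would give x = 0, where B equals 1. *)
  have Bx : fracB (fracTinv y) != 0.
    apply/eqP => B0; move: E; rewrite B0.
    have -> : mul 0 y = 0 by rewrite -[0 in LHS](scale0r 0) mulZl scale0r.
    by move=> E; move: B0; rewrite -E fracB0; apply/eqP; exact: qone_neq0.
  have TE : fracT (fracTinv y) = y by rewrite /fracT -{2}E qinv_mul.
  by split=> //; split=> //; rewrite TE.
split; apply: ratf_smooth.
- exact: open_fracU.
- by apply: ratfS ratf_fracT => x [].
- exact: open_fracW.
- exact: ratf_fracTinv.
Qed.

(** With b = v M, orthogonality of k to v makes b imaginary with |b|^2 = |v|^2 |k|^2. Therefore (1 -
    t b)^{-1} = (1 + t b) / (1 + t^2 |b|^2), and substituting b v = |v|^2 k into its product with t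
    v gives [circle0_pt]; in the mirrored case the factors are in reverse order. *)
Lemma fracT_circle0 (v k : V) t : v != 0 -> dot v k = 0 ->
  dot v v *: k = mul (v *m M) v ->
  fracB (t *: v) != 0 /\ fracT (t *: v) = circle0_pt v k t.
Proof.
move=> v0 vk kE; have s0 : dot v v != 0 by rewrite dot_eq0.
pose b := v *m M; rewrite -/b in kE.
have b0 : b 0 e0 = 0.
  apply: (mulIf s0); rewrite -(dot_mul b v) -kE dotZr vk; ring.
have bb : dot b b = dot v v * dot k k.
  apply: (mulIf s0); rewrite -(norm_mul b v) -kE dotZl dotZr; ring.
have BE : fracB (t *: v) = qone - t *: b by rewrite /fracB -scalemxAl.
have B0 : fracB (t *: v) != 0.
  apply/eqP => /(congr1 (fun x : V => x 0 e0)); rewrite BE; move: (b) b0 => c c0.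
  by rewrite !mxE /= c0 mulr0 subr0 => /eqP; rewrite oner_eq0.
split=> //; rewrite /fracT.
suff E : mul (fracB (t *: v)) (circle0_pt v k t) = t *: v by rewrite -{2}E qinv_mul.
rewrite mul_fracB -scalemxAl -/b mulZl /circle0_pt.
have -> : (t * dot v v) *: k = t *: mul b v by rewrite -scalerA kE.
rewrite mulZ mulD mulZ mul_sq b0 bb.
have D0 : 1 + t ^+ 2 * (dot v v * dot k k) != 0 by rewrite gt_eqF ?circle0_den.
move: (mul b v) => z; apply/rowP => i; rewrite !mxE; field.
exact: D0.
Qed.

End QuaternionicFractions.

Lemma fracTinv_line (R : realType) (mul : R4 R -> R4 R -> R4 R) (M : 'M[R]_4) (v k : R4 R) :
  mul = @qmul R \/ mul = (fun x y => qmul y x) -> v != 0 -> dot v k = 0 ->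
  dot v v *: k = mul (v *m M) v ->
  maps_germ_into_line (fracTinv mul M) (circle0 v k).
Proof.
move=> mulE v0 vk kE; exists (line_set 0 v); split; first by exists 0, v.
have [_ [oW [U0 [_ [TK _]]]]] := fracT_local_diffeo0 mulE M.
have W0 : fracW mul M 0 by have [] := TK 0 U0; rewrite (fracT0 mulE).
have Wn : \forall x \near (0 : R4 R), fracW mul M x by exact: open_nbhs_nbhs.
have pF : polyf (fun x : R4 R => dot x x * dot k k).
  apply: polyf_mul; last exact: polyf_cst.
  by apply: polyf_dot => i; exact: polyf_coord.
have small : \forall x \near (0 : R4 R), dot x x * dot k k < 1.
  have c0 := @polyf_continuous _ _ pF (0 : R4 R).
  apply: (c0 [set y | y < 1]); apply: open_nbhs_nbhs; split; first exact: open_lt.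
  by rewrite /= dotE !mxE !mul0r !addr0 mul0r ltr01.
apply: filterS2 Wn small => x Wx xk Cx.
have [t xE] := circle0_surj v0 vk Cx xk.
have [B0 TE] := fracT_circle0 mulE t v0 vk kE.
have Utv : fracU mul M (t *: v) by split=> //; rewrite TE -xE.
exists t => //; rewrite add0r xE -TE.
by have [_ ->] := TK _ Utv.
Qed.

Theorem theorem3 (R : realType) (S : set (set (R4 R))) :
  simple_bundle S -> tangent_zariski_dense S -> rectifiable S ->
  exists A B : R4 R -> R4 R, affine A /\ affine B /\
    exists T : R4 R -> R4 R,
      ((forall x, T x = qmul (qinv (B x)) (A x)) \/
       (forall x, T x = qmul (A x) (qinv (B x)))) /\
      B 0 != 0 /\ T 0 = 0 /\
      exists (Tinv : R4 R -> R4 R) (U W : set (R4 R)),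
        local_diffeo0 T Tinv U W /\
        forall C, S C -> maps_germ_into_line Tinv C.
Proof.
move=> Ss Sd Sr; have [w [M [vw wk HM]]] := rectifiable_second_jet Sd Sr.
have [mul mulE wE] : exists2 mul : R4 R -> R4 R -> R4 R,
    mul = @qmul R \/ mul = (fun x y => qmul y x) & forall v, w v = mul (v *m M) v.
  by case: HM => wE; [exists (@qmul R)|exists (fun x y => qmul y x)]; auto.
exists id, (fracB M); split; first by exists 1%:M, 0 => x; rewrite mulmx1 addr0.
split; first by exists (- M), (qone R) => x; rewrite /fracB mulmxN addrC.
exists (fracT mul M); split; first by case: mulE => ->; [left|right].
split; first by rewrite fracB0 qone_neq0.
split; first exact: fracT0.
exists (fracTinv mul M), (fracU mul M), (fracW mul M).
split; first exact: fracT_local_diffeo0.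
move=> C SC.
(* The second jet speaks about tangent vectors, so one is produced from the parameter at which C
   passes through 0. *)
have [v Cv] : exists v, tangent_dir0 C v.
  have [Cc C0] := Ss.1 C SC; case: Cc => [[c [u [u' [r [r0 [uu CE]]]]]]|[p [d [d0 CE]]]].
    move: C0; rewrite CE => -[t _ t0].
    by exists ((- (r * sin t)) *: u + (r * cos t) *: u'); left; exists c, u, u', r, t.
  move: C0; rewrite CE => -[t _ t0].
  by exists d; right; exists p, d, t.
have [k [v0 vk -> wvk]] := wk C v SC Cv.
by apply: fracTinv_line => //; rewrite -wE wvk.
Qed.
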